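(* Let $n\in\mathbb{N}$, $n\ge 1$, let $X_{2n+1}(t)$ be the pseudo-process governed by the Cauchy problem $\frac{\partial u}{\partial t}(x,t)=(-1)^n\frac{\partial^{2n+1}u}{\partial x^{2n+1}}(x,t)$, $x\in\mathbb{R}$, $t>0$, $u(x,0)=\delta(x)$, and let $S_\theta(t)$ be a stable subordinator of exponent $\theta$, $0<\theta<1$, independent of $X_{2n+1}(t)$. If $\theta(2n+1)>1$, then for all $t>0$ and $x\in\mathbb{R}\setminus\{0\}$ $$\mathbb{P}(X_{2n+1}(S_{\theta}(t))\in dx)/dx=\frac{1}{\pi x}\,\mathbb{E}\left[e^{-b_n x\,G_{\theta(2n+1)}(1/t)}\sin\left(a_n x\,G_{\theta(2n+1)}(1/t)\right)\right],$$ where $G_{\gamma}(\tau)$ is a random variable with generalized gamma distribution having probability density function $$g_{\gamma}(y;\tau)=\gamma\frac{y^{\gamma-1}}{\tau}\exp\left(-\frac{y^{\gamma}}{\tau}\right),\qquad y,\gamma,\tau>0,$$ and $$a_n=\cos\frac{\pi}{2(2n+1)},\qquad b_n=\sin\frac{\pi}{2(2n+1)}.$$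
   Context: The pseudo-density of $X_{2n+1}(t)$ is the (signed) fundamental solution of the Cauchy problem, namely $$u_{2n+1}(x,t)=\frac{1}{\pi}\int_0^{+\infty}\cos\left(\gamma x+t\gamma^{2n+1}\right)d\gamma,\qquad x\in\mathbb{R},\ t>0,$$ where the integral is a (conditionally convergent) improper integral. The stable subordinator $S_\theta(t)$ has characteristic function $\mathbb{E}[e^{i\gamma S_\theta(t)}]=e^{-t|\gamma|^{\theta}e^{-i\frac{\theta\pi}{2}\operatorname{sgn}\gamma}}$, $\gamma\in\mathbb{R}$; its probability density on $(0,\infty)$ is denoted by $h_\theta(s,t)$. The pseudo-density of the subordinated pseudo-process is by definition $$\mathbb{P}(X_{2n+1}(S_{\theta}(t))\in dx)/dx=\int_0^{+\infty}u_{2n+1}(x,s)\,h_\theta(s,t)\,ds.$$ *)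

(* Defs.v *)
From HB Require Import structures.
From mathcomp Require Import all_boot all_order all_algebra.
From mathcomp Require Import all_classical all_reals all_analysis.
From mathcomp Require Import complex.

Set Implicit Arguments.
Unset Strict Implicit.
Unset Printing Implicit Defensive.

Import Order.TTheory GRing.Theory Num.Theory.
Import numFieldNormedType.Exports.

Local Open Scope classical_set_scope.
Local Open Scope ring_scope.
Local Open Scope complex_scope.

Definition cexp {R : realType} (z : R[i]) : R[i] :=
  (expR (complex.Re z))%:C * (cos (complex.Im z) +i* sin (complex.Im z)).

Definition char_fun {R : realType} d (T : measurableType d)
    (P : probability T R) (X : T -> R) (g : R) : R[i] :=
  fine 'E_P[fun w => cos (g * X w)] +i* fine 'E_P[fun w => sin (g * X w)].

(* The law of X is carried by (0, +oo), with density f there; the values of f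
   outside (0, +oo) are irrelevant. *)
Definition has_density_on_pos {R : realType} d (T : measurableType d)
    (P : probability T R) (X : {RV P >-> R}) (f : R -> R) : Prop :=
  [/\ measurable_fun (`]0, +oo[%classic : set R) f,
      forall y, 0 < y -> 0 <= f y
    & forall A : set R, measurable A ->
        distribution P X A =
        (\int[lebesgue_measure]_(y in A `&` `]0%R, +oo[%classic) (f y)%:E)%E].

(* The product rule for all m events with arbitrary A i gives the one for
   subfamilies by taking A i = setT. *)
Definition independent_family {R : realType} d (T : measurableType d)
    (P : probability T R) (m : nat) (X : 'I_m -> T -> R) : Prop :=
  forall A : 'I_m -> set R, (forall i, measurable (A i)) ->
    P [set w | forall i, A i (X i w)] =
    (\prod_(i < m) fine (P (X i @^-1` A i)))%:E.

(* Only the indices t >= 0 of the family S are constrained. *)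
Definition subordinator {R : realType} d (T : measurableType d)
    (P : probability T R) (S : R -> {RV P >-> R}) : Prop :=
  [/\ {ae P, forall w, S 0 w = 0},
      forall (m : nat) (s : nat -> R), 0 <= s 0%N ->
        (forall k, s k <= s k.+1) ->
        independent_family P
          (fun (i : 'I_m) w => S (s i.+1) w - S (s i) w),
      forall (s t : R) (A : set R), 0 <= s -> 0 <= t -> measurable A ->
        P [set w | A (S (s + t) w - S s w)] = P [set w | A (S t w)],
      {ae P, forall w, forall s t, 0 <= s -> s <= t -> S s w <= S t w}
    & {ae P, forall w, forall t, 0 <= t ->
        (S r w @[r --> t^'+] --> S t w)}].

Definition stable_subordinator {R : realType} d (T : measurableType d)
    (P : probability T R) (theta : R) (S : R -> {RV P >-> R}) : Prop :=
  subordinator S /\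
  forall t g : R, 0 <= t ->
    char_fun P (S t) g =
    cexp (- (t * `|g| `^ theta)%:C
          * cexp (- (0 +i* (theta * pi / 2 * Num.sg g)))).

Definition improper_integral {R : realType} (f : R -> R) : R :=
  lim ((\int[lebesgue_measure]_(y in `[0, M]%classic) f y) @[M --> +oo]).

(* Fundamental solution u_(2n+1)(x, t) of
   d/dt u = (-1)^n d^(2n+1)/dx^(2n+1) u,  u(x, 0) = delta(x). *)
Definition pseudo_density {R : realType} (n : nat) (x t : R) : R :=
  pi^-1 * improper_integral (fun g => cos (g * x + t * g ^+ (2 * n + 1))).

(* Kept extended-real valued: equality with a finite number then includes the
   integrability of the integrand. *)
Definition subordinated_density {R : realType} (n : nat) (h : R -> R -> R)
    (x t : R) : \bar R :=
  (\int[lebesgue_measure]_(s in `]0%R, +oo[%classic)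
     (pseudo_density n x s * h s t)%R%:E)%E.

Definition gen_gamma_pdf {R : realType} (gamma y tau : R) : R :=
  gamma * (y `^ (gamma - 1) / tau) * expR (- (y `^ gamma / tau)).

Definition coef_a {R : realType} (n : nat) : R := cos (pi / (2 * (2 * n + 1)%:R)).
Definition coef_b {R : realType} (n : nat) : R := sin (pi / (2 * (2 * n + 1)%:R)).

(* Main.v *)
From HB Require Import structures.
Require Import Defs.
From mathcomp Require Import all_boot all_order all_algebra.
From mathcomp Require Import all_classical all_reals all_analysis.
From mathcomp Require Import measurable_realfun complex ring lra zify.

(* With [m = 2n + 1], rotating the ray [0, +oo) by the angle [pi / (2 m)] turns
   the oscillating phase [exp (i s z ^ m)] into [exp (- s r ^ m)], so that
   [pi u(x, s)] becomes an absolutely convergent integral over [r] in which [s]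
   only enters through [exp (- s r ^ m)].  Averaging over the law of the
   subordinator replaces this factor by the Laplace transform
   [exp (- t r ^ (theta m))], and an integration by parts in [r] produces the
   generalized gamma density.

   The Laplace transform is recovered from the characteristic function by
   testing both against [exp (- u ^ 2)]: for [f z = exp (- c z ^ alpha)] and
   [z = l exp (s u)], shifting [u] to [u + i pi / (2 s)] moves the values of [f]
   on the positive half-line to values on the imaginary axis; letting [s] tend
   to [0] then isolates [f l].

   Contours are never used explicitly: if [p + i q] satisfies the
   Cauchy-Riemann equations in (rescaled) coordinates [(u, v)], the derivative
   in [v] of the integral over [u] in [a, b] of [Re (exp (p + i q))] is a
   difference of boundary terms at [a] and [b]. *)

Import Order.TTheory GRing.Theory Num.Theory.
Import numFieldNormedType.Exports.

Local Open Scope classical_set_scope.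
Local Open Scope ring_scope.

(** * Derivatives and continuity of explicit expressions *)

Section Calculus.
Context {R : realType}.
Implicit Types (f g : R -> R) (x a b c : R).

Lemma is_derive_add f g x a b : is_derive x 1 f a -> is_derive x 1 g b ->
  is_derive x 1 (fun y => f y + g y) (a + b).
Proof. by move=> ? ?; exact: (is_deriveD (f := f) (g := g)). Qed.

Lemma is_derive_opp f x a : is_derive x 1 f a -> is_derive x 1 (fun y => - f y) (- a).
Proof. by move=> ?; exact: (is_deriveN (f := f)). Qed.

Lemma is_derive_mul f g x a b : is_derive x 1 f a -> is_derive x 1 g b ->
  is_derive x 1 (fun y => f y * g y) (f x * b + g x * a).
Proof. by move=> ? ?; exact: (is_deriveM (f := f) (g := g)). Qed.

Lemma is_derive_compR (h : R -> R) f x a b : is_derive (f x) 1 h b ->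
  is_derive x 1 f a -> is_derive x 1 (fun y => h (f y)) (b * a).
Proof. by move=> ? ?; exact: (is_derive1_comp (f := h) (g := f)). Qed.

Lemma is_derive_expn f x a n : is_derive x 1 f a ->
  is_derive x 1 (fun y => f y ^+ n) (n%:R * f x ^+ n.-1 * a).
Proof.
move=> fa; rewrite (_ : (fun y => _) = f ^+ n); first exact: is_deriveX.
by apply/funext => y; rewrite exprfctE.
Qed.

Lemma is_derive_idR (x : R) : is_derive x 1 (fun y => y) (1 : R).
Proof. exact: is_derive_id. Qed.

Lemma is_derive_cstR c x : is_derive x 1 (fun=> c) (0 : R).
Proof. exact: is_derive_cst. Qed.

Context {T : topologicalType}.
Implicit Types F G : T -> R.

Lemma continuous_add F G : continuous F -> continuous G -> continuous (fun y => F y + G y).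
Proof. by move=> cF cG x; apply: cvgD; [exact: cF|exact: cG]. Qed.

Lemma continuous_opp F : continuous F -> continuous (fun y => - F y).
Proof. by move=> cF x; apply: cvgN; exact: cF. Qed.

Lemma continuous_mul F G : continuous F -> continuous G -> continuous (fun y => F y * G y).
Proof. by move=> cF cG x; apply: cvgM; [exact: cF|exact: cG]. Qed.

Lemma continuous_compR (h : R -> R) F : continuous h -> continuous F ->
  continuous (fun y => h (F y)).
Proof. by move=> ch cF x; apply: continuous_comp; [exact: cF|exact: ch]. Qed.

Lemma continuous_expn F n : continuous F -> continuous (fun y => F y ^+ n).
Proof.
move=> cF; apply: (@continuous_compR (fun x : R => x ^+ n)) => //.
exact: exprn_continuous.
Qed.

End Calculus.

(** [der0] follows the syntax of the function and builds its derivative by unification; [der] then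
    leaves the equation with the expected derivative. What is not recognised, such as a real power,
    is looked up among the hypotheses. *)
Ltac der0 := lazymatch goal with
 | |- is_derive _ _ (fun=> ?c) _ => eapply is_derive_cstR
 | |- is_derive _ _ (fun y => y) _ => eapply is_derive_idR
 | |- is_derive _ _ (fun y => @?f y + @?g y) _ => eapply (is_derive_add f g); der0
 | |- is_derive _ _ (fun y => - @?f y) _ => eapply (is_derive_opp f); der0
 | |- is_derive _ _ (fun y => @?f y * @?g y) _ => eapply (is_derive_mul f g); der0
 | |- is_derive _ _ (fun y => @?f y ^+ ?n) _ => eapply (is_derive_expn f); der0
 | |- is_derive _ _ (fun y => expR (@?f y)) _ =>
     eapply (is_derive_compR expR f); [eapply is_derive_expR|der0]
 | |- is_derive _ _ (fun y => sin (@?f y)) _ =>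
     eapply (is_derive_compR sin f); [eapply is_derive_sin|der0]
 | |- is_derive _ _ (fun y => cos (@?f y)) _ =>
     eapply (is_derive_compR cos f); [eapply is_derive_cos|der0]
 | |- _ => eassumption || eauto
 end.
Ltac der := eapply is_derive_eq; [der0|cbv beta].

Ltac cnt := lazymatch goal with
 | |- continuous (fun=> ?c) => (by move=> ?; exact: cst_continuous)
 | |- continuous (fun y => y) => by move=> ?; exact: cvg_id
 | |- continuous (fun y => fst y) => by move=> ?; exact: cvg_fst
 | |- continuous (fun y => snd y) => by move=> ?; exact: cvg_snd
 | |- continuous (fun y => @?f y + @?g y) => apply: (@continuous_add _ _ f g); cnt
 | |- continuous (fun y => - @?f y) => apply: (@continuous_opp _ _ f); cnt
 | |- continuous (fun y => @?f y * @?g y) => apply: (@continuous_mul _ _ f g); cnt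
 | |- continuous (fun y => @?f y ^+ ?n) => apply: (@continuous_expn _ _ f); cnt
 | |- continuous (fun y => expR (@?f y)) =>
     apply: (@continuous_compR _ _ expR f); [exact: continuous_expR|cnt]
 | |- continuous (fun y => sin (@?f y)) =>
     apply: (@continuous_compR _ _ sin f); [exact: continuous_sin|cnt]
 | |- continuous (fun y => cos (@?f y)) =>
     apply: (@continuous_compR _ _ cos f); [exact: continuous_cos|cnt]
 | |- _ => by eauto
 end.

(** * Contour deformation by differentiation in a parameter *)

Section Green.
Context {R : realType}.
Notation mu := (@lebesgue_measure R).

Lemma continuous_integrable_itv (f : R -> R) (a b : R) : continuous f ->
  mu.-integrable `[a, b] (EFin \o f).
Proof.
move=> cf; apply: continuous_compact_integrable; first exact: segment_compact.
exact: continuous_subspaceT.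
Qed.

Lemma Rintegral_FTC (F f : R -> R) (a b : R) : a <= b -> continuous f ->
  (forall x : R, is_derive x 1 F (f x)) ->
  \int[mu]_(x in `[a, b]) f x = F b - F a.
Proof.
move=> ab cf dF.
have cF : continuous F.
  by move=> x; apply/differentiable_continuous/derivable1_diffP; case: (dF x).
move: ab; rewrite le_eqVlt => /predU1P[<-|ab].
  by rewrite set_itv1 Rintegral_set1 subrr.
rewrite /Rintegral (@continuous_FTC2 _ f F)//.
- exact: continuous_subspaceT.
- split=> [x _| |]; first by case: (dF x).
  + exact/cvg_at_right_filter/cF.
  + exact/cvg_at_left_filter/cF.
- by move=> x _; rewrite derive1E; case: (dF x) => _ ->.
Qed.

(** Compactness of the rectangle provides the constant that dominates the parameter derivative under
    the integral sign. *)
Lemma continuous_bounded_rect (f : R * R -> R) (a b c d : R) : continuous f ->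
  exists2 M, 0 <= M &
  forall x y, a <= x <= b -> c <= y <= d -> `|f (x, y)| <= M.
Proof.
move=> cf.
have : compact (f @` (`[a, b]%classic `*` `[c, d]%classic)).
  apply: continuous_compact; first exact: continuous_subspaceT.
  by apply: compact_setX; exact: segment_compact.
move=> /compact_bounded [N [_ /(_ (Num.max 0 N + 1))]].
have /[swap]/[apply] : N < Num.max 0 N + 1.
  by rewrite (le_lt_trans (_ : _ <= Num.max 0 N)) ?le_max ?lexx ?orbT// ltrDl.
move=> H; exists (Num.max 0 N + 1); first by rewrite addr_ge0// le_max lexx.
by move=> x y xab ycd; apply: H; exists (x, y).
Qed.

(* The hypotheses on [p', q'] are the Cauchy-Riemann equations for
   [w u * exp (p + i q)]; [w u = 1] for a strip and [w r = r] for a sector in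
   polar coordinates. *)
Lemma is_derive_contour_integral (p q p' q' pu qu : R -> R -> R) (w w' : R -> R) (a b : R) :
  a <= b ->
  (forall v u : R, is_derive v 1 (p ^~ u) (p' v u)) ->
  (forall v u : R, is_derive v 1 (q ^~ u) (q' v u)) ->
  (forall v u : R, is_derive u 1 (p v) (pu v u)) ->
  (forall v u : R, is_derive u 1 (q v) (qu v u)) ->
  (forall u : R, is_derive u 1 w (w' u)) ->
  (forall v u, p' v u = - (w u * qu v u)) ->
  (forall v u, q' v u = w' u + w u * pu v u) ->
  continuous (fun z : R * R => p z.1 z.2) -> continuous (fun z : R * R => q z.1 z.2) ->
  continuous (fun z : R * R => p' z.1 z.2) -> continuous (fun z : R * R => q' z.1 z.2) ->
  forall v : R, is_derive v 1
    (fun v => \int[mu]_(u in `[a, b]) (expR (p v u) * cos (q v u)))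
    (w a * (expR (p v a) * sin (q v a)) - w b * (expR (p v b) * sin (q v b))).
Proof.
move=> ab dp dq dpu dqu dw CR1 CR2 cp cq cp' cq' v.
pose f v u := expR (p v u) * cos (q v u).
pose f' v u := expR (p v u) * (p' v u * cos (q v u) - q' v u * sin (q v u)).
have df (x u : R) : is_derive x 1 (f ^~ u) (f' x u).
  by rewrite /f /f'; der; ring.
have cf : continuous (fun z : R * R => f z.1 z.2) by rewrite /f; cnt.
have cf' : continuous (fun z : R * R => f' z.1 z.2) by rewrite /f'; cnt.
have slice (g : R -> R -> R) (x : R) : continuous (fun z : R * R => g z.1 z.2) -> continuous (g x).
  by move=> cg; have [_ /(_ x)] := continuous_curry cg.
have [M M0 HM] := continuous_bounded_rect _ (v - 1) (v + 1) a b cf'.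
have I0 : `](v - 1), (v + 1)[%classic v by rewrite /= in_itv/=; apply/andP; split; lra.
have d1E (x u : R) : partial1of2 f x u = f' x u.
  by rewrite partial1of2E; case: (df x u).
have bd : forall x y, `](v - 1), (v + 1)[%classic x -> `[a, b]%classic y ->
    `|partial1of2 f x y| <= cst M y.
  move=> x y /=; rewrite !in_itv/= d1E => /andP[? ?] ?; apply: HM => //.
  by apply/andP; split; lra.
have mI : measurable (`[a, b]%classic : set R) by [].
have intf (x : R) : `](v - 1), (v + 1)[%classic x -> mu.-integrable `[a, b] (EFin \o f x).
  by move=> _; apply/continuous_integrable_itv/slice.
have derf (x y : R) : `](v - 1), (v + 1)[%classic x -> `[a, b]%classic y -> derivable (f ^~ y) x 1.
  by move=> _ _; case: (df x y).
have intM : mu.-integrable `[a, b] (EFin \o cst M).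
  by apply: continuous_integrable_itv; move=> ?; exact: cst_continuous.
have H1 := @derivable_under_integral _ _ _ mu f _ mI _ _ _ I0 intf derf _ (fun=> M0) intM bd.
have H2 := @differentiation_under_integral _ _ _ mu f _ mI _ _ _ I0 intf derf _ (fun=> M0) intM bd.
apply: DeriveDef; first exact: H1.
rewrite -derive1E [LHS]H2.
under eq_Rintegral do rewrite d1E.
(* By the Cauchy-Riemann equations the [v]-derivative of the integrand is also a [u]-derivative, so
   its integral reduces to boundary values. *)
have dG (u : R) : is_derive u 1 (fun u => - (w u * (expR (p v u) * sin (q v u)))) (f' v u).
  by der; rewrite /f' CR1 CR2; ring.
by rewrite (Rintegral_FTC _ _ a b ab (slice _ v cf') dG); ring.
Qed.

(** [G - F] and [G + F] have nonnegative derivatives on [[c, d]], hence are nondecreasing. This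
    bounds the change of a contour integral by a primitive of the bound on its edge terms. *)
Lemma ler_derive_dist (F G F' G' : R -> R) (c d : R) : c <= d ->
  (forall x : R, is_derive x 1 F (F' x)) -> (forall x : R, is_derive x 1 G (G' x)) ->
  (forall x, c <= x <= d -> `|F' x| <= G' x) ->
  `|F d - F c| <= G d - G c.
Proof.
move=> cd dF dG FG.
have main (e : R) : `|e| = 1 -> e * F d - e * F c <= G d - G c.
  move=> e1.
  pose H x := G x - e * F x.
  have dH (x : R) : is_derive x 1 H (G' x - e * F' x) by rewrite /H; der; ring.
  suff : H c <= H d by rewrite /H; lra.
  apply: (@ger0_derive1_ndecr _ H c d) => //.
  - move=> x; rewrite in_itv/= => /andP[cx xd].
    rewrite derive1E; case: (dH x) => _ ->.
    rewrite subr_ge0 (le_trans (ler_norm _))// normrM e1 mul1r FG//.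
    by rewrite !ltW.
  - apply: continuous_subspaceT => x.
    by apply/differentiable_continuous/derivable1_diffP; case: (dH x).
rewrite ler_norml; apply/andP; split.
- by have := main (-1) (normrN1 _); lra.
- by have := main 1 (normr1 _); lra.
Qed.

End Green.

(** * Dominated convergence and the Gaussian contour shift *)

Lemma measurable_fun_expn {d} {T : measurableType d} {R : realType} (D : set T) (f : T -> R) n :
  measurable_fun D f -> measurable_fun D (fun x => f x ^+ n).
Proof. exact: measurable_funX. Qed.

Lemma measurable_fun_compR {d} {T : measurableType d} {R : realType} (D : set T) (h : R -> R)
  (f : T -> R) : measurable_fun setT h -> measurable_fun D f ->
  measurable_fun D (fun x => h (f x)).
Proof. by move=> mh mf; exact: (measurableT_comp mh mf). Qed.

Ltac msr := lazymatch goal with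
 | |- measurable_fun _ (fun=> ?c) => exact: measurable_cst
 | |- measurable_fun _ (fun y => y) => exact: measurable_id
 | |- measurable_fun _ (fun y => fst y) => exact: measurable_fst
 | |- measurable_fun _ (fun y => snd y) => exact: measurable_snd
 | |- measurable_fun _ (fun y => @?f y + @?g y) =>
     apply: (@measurable_funD _ _ _ _ f g); msr
 | |- measurable_fun _ (fun y => - @?f y) => apply: (@measurable_funN _ _ _ _ f); msr
 | |- measurable_fun _ (fun y => @?f y * @?g y) =>
     apply: (@measurable_funM _ _ _ _ f g); msr
 | |- measurable_fun _ (fun y => @?f y ^+ ?n) => apply: (@measurable_fun_expn _ _ _ _ f); msr
 | |- measurable_fun _ (fun y => expR (@?f y)) =>
     apply: (@measurable_fun_compR _ _ _ _ expR f); [exact: measurable_expR|msr]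
 | |- measurable_fun _ (fun y => sin (@?f y)) =>
     apply: (@measurable_fun_compR _ _ _ _ sin f);
     [apply: continuous_measurable_fun; exact: continuous_sin|msr]
 | |- measurable_fun _ (fun y => cos (@?f y)) =>
     apply: (@measurable_fun_compR _ _ _ _ cos f);
     [apply: continuous_measurable_fun; exact: continuous_cos|msr]
 | |- measurable_fun _ (fun y => `|@?f y|) =>
     apply: (@measurable_fun_compR _ _ _ _ Num.norm f); [exact: normr_measurable|msr]
 | |- measurable_fun _ (fun y => (@?f y) `^ ?p) =>
     apply: (@measurable_fun_compR _ _ _ _ (fun z => z `^ p) f); [exact: measurable_powR|msr]
 | |- _ => solve [eauto | exact: measurable_funTS; eauto]
 end.

Section Integration.
Context {d} {T : measurableType d} {R : realType}.
Variable mu : {measure set T -> \bar R}.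
Implicit Types (D : set T) (f g : T -> R).

Lemma integrable_dominated D f g : measurable D -> measurable_fun D f ->
  (forall x, D x -> `|f x| <= g x) -> mu.-integrable D (EFin \o g) ->
  mu.-integrable D (EFin \o f).
Proof.
move=> mD mf fg; apply: le_integrable => //; first exact/measurable_EFinP.
move=> x Dx /=; rewrite lee_fin (le_trans (fg x Dx))//.
exact: ler_norm.
Qed.

Lemma integrable_mull D (k : R) f : measurable D ->
  mu.-integrable D (EFin \o f) ->
  mu.-integrable D (EFin \o (fun x => k * f x)).
Proof. by move=> mD /(integrableZl mD k). Qed.

Lemma cvg_Rintegral_dominated D (f_ : nat -> T -> R) f g : measurable D ->
  (forall n, measurable_fun D (f_ n)) ->
  (forall x, D x -> f_ n x @[n --> \oo] --> f x) ->
  (forall n x, D x -> `|f_ n x| <= g x) ->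
  mu.-integrable D (EFin \o g) ->
  \int[mu]_(x in D) f_ n x @[n --> \oo] --> \int[mu]_(x in D) f x.
Proof.
move=> mD mf_ cf fg ig.
have mf : measurable_fun D f.
  by apply: (measurable_fun_cvg mf_) => x Dx; exact: cf.
have f_g n x : D x -> (`|(f_ n x)%:E| <= (g x)%:E)%E.
  by move=> Dx; rewrite lee_fin fg.
have fgl x : D x -> `|f x| <= g x.
  move=> Dx; have /cvg_norm H := cf x Dx.
  rewrite -(cvg_lim _ H)//; apply: limr_le; first by apply/cvg_ex; eexists; exact: H.
  by near=> n; rewrite fg.
apply: fine_cvg; rewrite fineK.
  apply: (@dominated_cvg _ _ _ mu D mD (fun n x => (f_ n x)%:E) _ (EFin \o g)) => //.
  - by move=> n; exact/measurable_EFinP.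
  - by move=> x Dx; apply: cvg_EFin; [exact: nearW|exact: cf].
apply: integrable_fin_num => //.
exact: (integrable_dominated _ _ g).
Unshelve. all: end_near. Qed.

(** The restrictions of [f] to [D_ n] are dominated by [|f|] and at each point of [D] eventually
    equal to [f]. *)
Lemma cvg_Rintegral_exhaust D (D_ : nat -> set T) f : measurable D ->
  (forall n, measurable (D_ n)) -> (forall n, D_ n `<=` D) ->
  (forall x, D x -> \forall n \near \oo, D_ n x) ->
  mu.-integrable D (EFin \o f) ->
  \int[mu]_(x in D_ n) f x @[n --> \oo] --> \int[mu]_(x in D) f x.
Proof.
move=> mD mD_ DD Dn intf.
have mf : measurable_fun D f by apply/measurable_EFinP; case/integrableP: intf.
rewrite (_ : (fun n => _) = fun n => \int[mu]_(x in D) (f \_ (D_ n)) x); last first.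
  by apply/funext => n; rewrite -Rintegral_mkcondl setIidl.
apply: (@cvg_Rintegral_dominated _ _ _ (fun x => `|f x|)) => //.
- move=> n; apply/measurable_restrict => //.
  exact: measurable_funS mf.
- move=> x Dx; apply: cvg_near_cst.
  by apply: filterS (Dn x Dx) => n Dnx; rewrite patchE mem_set.
- by move=> n x Dx; rewrite patchE; case: ifP => // _; rewrite normr0.
- exact: integrable_norm.
Qed.

End Integration.

Section StripShift.
Context {R : realType}.
Notation mu := (@lebesgue_measure R).

Lemma cvg_Rintegral_sym (f : R -> R) : mu.-integrable setT (EFin \o f) ->
  \int[mu]_(x in `[- n%:R, n%:R]) f x @[n --> \oo] --> \int[mu]_x f x.
Proof.
move=> intf; apply: cvg_Rintegral_exhaust => // x _.
near=> n => /=; rewrite in_itv/= -ler_norml.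
by near: n; exact: nbhs_infty_ger.
Unshelve. all: end_near. Qed.

Lemma cos_ge0_itv (x : R) : 0 <= x <= pi / 2 -> 0 <= cos x.
Proof.
move=> /andP[x0 x1]; apply: cos_ge0_pihalf; rewrite x1 andbT.
by rewrite (le_trans _ x0)// oppr_le0 divr_ge0// pi_ge0.
Qed.

(** The right-hand side is the real part of the integral after [u] is replaced by [u + i v]. As
    [b v] is at most [pi / 2], the factor [cos (b x)] stays nonnegative for [x] in [[0, v]]: the
    double exponential can only damp, and the modulus is at most [exp (v ^ 2 - u ^ 2)] throughout
    the strip. *)
Lemma gauss_contour_shift (C b v : R) : 0 <= C -> 0 <= b -> 0 <= v ->
  b * v <= pi / 2 ->
  \int[mu]_u expR (- u ^+ 2 - C * expR (b * u)) =
  \int[mu]_u (expR (v ^+ 2 - u ^+ 2 - C * expR (b * u) * cos (b * v)) *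
              cos (2 * u * v + C * expR (b * u) * sin (b * v))).
Proof.
move=> C0 b0 v0 bv.
pose p v u := v ^+ 2 - u ^+ 2 - C * expR (b * u) * cos (b * v).
pose q v u := - (2 * u * v) - C * expR (b * u) * sin (b * v).
have pub x y : 0 <= x <= v -> p x y <= v ^+ 2 - y ^+ 2.
  move=> /andP[x0 xv]; rewrite /p lerBlDr -[leLHS]addr0 lerD//.
    by rewrite lerD2r ler_pXn2r.
  rewrite !mulr_ge0// ?expR_ge0// cos_ge0_itv// mulr_ge0//=.
  by rewrite (le_trans _ bv)// ler_wpM2l.
have intE x : 0 <= x <= v -> mu.-integrable setT
    (EFin \o (fun u => expR (p x u) * cos (q x u))).
  move=> x0v.
  apply: (@integrable_dominated _ _ _ mu _ _ (fun u => expR (v ^+ 2) * gauss_fun u)) => //.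
  - by rewrite /p /q; msr.
  - move=> y _; rewrite normrM ger0_norm ?expR_ge0// /gauss_fun -expRD.
    rewrite -[leRHS]mulr1 ler_pM ?expR_ge0 ?ler_expR ?pub//.
    by rewrite ler_norml cos_geN1 cos_le1.
  - by apply: integrable_mull => //; exact: integrableT_gauss.
pose F (L x : R) := \int[mu]_(u in `[- L, L]) (expR (p x u) * cos (q x u)).
(* Each of the two vertical edges, at [u = n] and [u = - n], contributes at most
   [exp (v ^ 2 - n ^ 2)] per unit of height. *)
have key (n : nat) : `|F n%:R v - F n%:R 0| <= 2 * expR (v ^+ 2 - n%:R ^+ 2) * v.
  have nn : - n%:R <= n%:R :> R by rewrite (@le_trans _ _ 0)// oppr_le0.
  have cp : continuous (fun z : R * R => p z.1 z.2) by rewrite /p; cnt.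
  have cq : continuous (fun z : R * R => q z.1 z.2) by rewrite /q; cnt.
  pose p' v u := 2 * v + C * expR (b * u) * b * sin (b * v).
  pose q' v u := - (2 * u) - C * expR (b * u) * b * cos (b * v).
  have cp' : continuous (fun z : R * R => p' z.1 z.2) by rewrite /p'; cnt.
  have cq' : continuous (fun z : R * R => q' z.1 z.2) by rewrite /q'; cnt.
  (* In the strip [w = 1], and the Cauchy-Riemann equations let [q'] and [- p'] serve as the
     [u]-derivatives of [p] and [q]. *)
  have dF := @is_derive_contour_integral R p q p' q' q' (fun v u => - p' v u) (fun=> 1) (fun=> 0)
    _ _ nn.
  have {}dF (x : R) : is_derive x 1 (F n%:R)
    (1 * (expR (p x (- n%:R)) * sin (q x (- n%:R))) -
     1 * (expR (p x n%:R) * sin (q x n%:R))).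
    apply: dF => //.
    + by move=> x1 u; rewrite /p /p'; der; ring.
    + by move=> x1 u; rewrite /q /q'; der; ring.
    + by move=> x1 u; rewrite /p /q'; der; ring.
    + by move=> x1 u; rewrite /q /p'; der; ring.
    + by move=> x1 u; ring.
    + by move=> x1 u; ring.
  have dG (x : R) : is_derive x 1 (fun x => 2 * expR (v ^+ 2 - n%:R ^+ 2) * x)
      (2 * expR (v ^+ 2 - n%:R ^+ 2)) by der; ring.
  apply: le_trans (ler_derive_dist (F n%:R) _ _ _ 0 v v0 dF dG _) _; last first.
    by rewrite mulr0 subr0.
  move=> x x0v; rewrite !mul1r mulrDl mul1r (le_trans (ler_normB _ _))//.
  have H y : `|expR (p x y) * sin (q x y)| <= expR (v ^+ 2 - y ^+ 2).
    rewrite normrM ger0_norm ?expR_ge0//.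
    rewrite -[leRHS]mulr1 ler_pM ?expR_ge0 ?ler_expR ?pub//.
    by rewrite ler_norml sin_geN1 sin_le1.
  by rewrite lerD// (le_trans (H _))// sqrrN.
have c0 : F n%:R v - F n%:R 0 @[n --> \oo] --> (0 : R).
  apply: norm_cvg0.
  apply: (@squeeze_cvgr _ _ _ _ (cst 0) (fun n => 2 * expR (v ^+ 2) * v * gauss_fun n%:R)).
  - near=> n; rewrite normr_ge0/= (le_trans (key n))// /gauss_fun expRD.
    by rewrite le_eqVlt; apply/orP; left; apply/eqP; ring.
  - exact: cvg_cst.
  - rewrite -[X in _ --> X](mulr0 (2 * expR (v ^+ 2) * v)); apply: cvgMl_tmp.
    by move/cvg_pinftyP: (@cvg_gauss_fun R); apply; exact: cvgr_idn.
have c1 : F n%:R v - F n%:R 0 @[n --> \oo] -->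
    \int[mu]_u (expR (p v u) * cos (q v u)) - \int[mu]_u (expR (p 0 u) * cos (q 0 u)).
  by apply: cvgB; apply: cvg_Rintegral_sym; apply: intE; rewrite ?lexx ?v0.
have /eqP : \int[mu]_u (expR (p v u) * cos (q v u)) -
    \int[mu]_u (expR (p 0 u) * cos (q 0 u)) = 0.
  exact: (cvg_unique _ c1 c0).
rewrite subr_eq0 => /eqP E.
transitivity (\int[mu]_u (expR (p 0 u) * cos (q 0 u))).
  apply: eq_Rintegral => u _; rewrite /p /q !mulr0 cos0 sin0 expr0n/= mulr0 oppr0 addr0.
  by rewrite cos0 !mulr1 add0r.
rewrite -E; apply: eq_Rintegral => u _.
by rewrite /q -opprD cosN.
Unshelve. all: end_near. Qed.

End StripShift.

(** * Contour rotation for the pseudo-density *)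

Section Growth.
Context {R : realType}.
Notation mu := (@lebesgue_measure R).

Lemma sin_le_id (v : R) : 0 <= v -> `|sin v| <= v.
Proof.
move=> v0.
have ds (x : R) : is_derive x 1 sin (cos x) by exact: is_derive_sin.
have di (x : R) : is_derive x 1 (fun y : R => y) 1 by exact: is_derive_idR.
have := ler_derive_dist sin _ _ _ 0 v v0 ds di.
rewrite sin0 !subr0; apply => x _.
by rewrite ler_norml cos_geN1 cos_le1.
Qed.

(** Put [w = v / 2]. Since [sin x - x cos x] has derivative [x sin x], one gets [sin w >= w cos w],
    so [sin v = 2 sin w cos w] is at least [2 w (cos w) ^ 2 = w (1 + cos v)], which is at least
    [w]. *)
Lemma sin_ge_half (v : R) : 0 <= v <= pi / 2 -> v / 2 <= sin v.
Proof.
move=> /andP[v0 v1].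
have dG (x : R) : is_derive x 1 (fun x => sin x - x * cos x) (x * sin x).
  by der; ring.
have d0 (x : R) : is_derive x 1 (fun=> 0 : R) 0 by exact: is_derive_cstR.
have w0 : 0 <= v / 2 by rewrite divr_ge0.
have pi0 := pi_gt0 R.
have := ler_derive_dist _ _ _ _ 0 (v / 2) w0 d0 dG.
rewrite subrr normr0 sin0 mul0r !subr0 => H.
have {}H : v / 2 * cos (v / 2) <= sin (v / 2).
  rewrite -subr_ge0; apply: H => x /andP[x0 xv]; rewrite mulr_ge0//.
  by apply: sin_ge0_pi; rewrite x0/=; lra.
have c0 : 0 <= cos (v / 2) by apply: cos_ge0_itv; rewrite w0/=; lra.
have cv : 0 <= cos v by apply: cos_ge0_itv; rewrite v0.
have vE : v = (v / 2) *+ 2 by rewrite -mulr_natr; field.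
move: cv; rewrite [in cos v]vE [in sin v]vE cos_mulr2n sin_mulr2n.
move: w0 H c0; set w := v / 2; set a := cos _; set b := sin _ => w0 H c0.
rewrite !mulr2n => cv; have := mulr_ge0 w0 cv; have := ler_wpM2r c0 H.
rewrite expr2; lra.
Qed.

(** [Y] solves [t Y ^ (g - 1) = c + 1]. Beyond [Y] the power exceeds [(c + 1) y], because [g > 1];
    up to [Y] the linear term is at most [(c + 1) Y]. *)
Lemma linear_powR_bound (c t g : R) : 0 <= c -> 0 < t -> 1 < g ->
  exists K, forall y, 0 <= y -> c * y - t * y `^ g <= K - y.
Proof.
move=> c0 t0 g1.
pose Y := ((c + 1) / t) `^ (g - 1)^-1.
have Y0 : 0 <= Y by exact: powR_ge0.
have g10 : 0 < g - 1 by rewrite subr_gt0.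
exists ((c + 1) * Y) => y y0.
have c1 : 0 <= c + 1 by rewrite addr_ge0.
have [yY|Yy] := leP y Y.
  have : 0 <= t * y `^ g by rewrite mulr_ge0 ?powR_ge0// ltW.
  have : (c + 1) * y <= (c + 1) * Y by rewrite ler_wpM2l.
  lra.
have : (c + 1) / t <= y `^ (g - 1).
  rewrite (_ : (c + 1) / t = Y `^ (g - 1)); last first.
    rewrite /Y -powRrM mulVf ?gt_eqF// powRr1// divr_ge0// ltW//.
  by apply: ge0_ler_powR; rewrite ?nnegrE ?(ltW g10)// ltW.
rewrite ler_pdivrMr// => H.
have : (c + 1) * y <= t * y `^ g.
  rewrite -(@mulr_powRB1 _ y g)//; last by rewrite (lt_trans ltr01).
  by rewrite (_ : t * (y * _) = y `^ (g - 1) * t * y) ?ler_wpM2r//; ring.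
have : 0 <= (c + 1) * Y by rewrite mulr_ge0.
lra.
Qed.

Lemma integrable_expRN : mu.-integrable `[0, +oo[ (EFin \o (fun y : R => expR (- y))).
Proof.
have := @integrable_exponential_pdf R 1 ltr01.
rewrite /exponential_pdf -restrict_EFin => /(integrable_mkcond _ _).2.
move=> /(_ (measurable_itv _)); apply: eq_integrable => // x _ /=.
by rewrite mul1r mulN1r.
Qed.

Lemma integrable_powR_decay (f : R -> R) (A c t g : R) :
  measurable_fun (`[0, +oo[%classic : set R) f -> 0 <= c -> 0 < t -> 1 < g ->
  (forall y, 0 <= y -> `|f y| <= A * expR (c * y - t * y `^ g)) ->
  mu.-integrable `[0, +oo[ (EFin \o f).
Proof.
move=> mf c0 t0 g1 fle.
have [K HK] := linear_powR_bound c t g c0 t0 g1.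
apply: (@integrable_dominated _ _ _ mu _ _ (fun y => `|A| * expR K * expR (- y))) => //.
  move=> y /=; rewrite in_itv/= andbT => y0; apply: le_trans (fle y y0) _.
  rewrite -mulrA -expRD ler_pM ?expR_ge0//; last by rewrite ler_expR HK.
    (* [A] is nonnegative: its product with a positive exponential bounds an absolute value. *)
    by rewrite -(pmulr_lge0 _ (expR_gt0 (c * y - t * y `^ g))) (le_trans _ (fle y y0)).
  exact: ler_norm.
by apply: integrable_mull => //; exact: integrable_expRN.
Qed.

Lemma cvg_Rintegral_itv0y (f : R -> R) : mu.-integrable `[0, +oo[ (EFin \o f) ->
  \int[mu]_(x in `[0, M]) f x @[M --> +oo] --> \int[mu]_(x in `[0, +oo[) f x.
Proof.
move=> intf; apply/cvg_pinftyP => u uoo.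
apply: cvg_Rintegral_exhaust => //.
- by move=> n x /=; rewrite !in_itv/= => /andP[->].
- move=> x /=; rewrite in_itv/= andbT => x0.
  by near=> n => /=; rewrite in_itv/= x0/=; near: n; move/cvgryPge: uoo; apply.
Unshelve. all: end_near. Qed.

End Growth.

Section Sector.
Context {R : realType}.
Notation mu := (@lebesgue_measure R).

(** The form [exp (i (x z + s z ^ m)) dz] is integrated along the segment of length [M] and argument
    [v], for [v] from [0] to [f0]. At [v = 0] this is the oscillating integral; at [v = f0] the
    phase [s z ^ m] has become pure damping. The two differ by the arc of radius [M], which vanishes
    in the limit. *)
Lemma cvg_sector_rotation (m : nat) (x s f0 : R) : (3 <= m)%N -> 0 < s ->
  m%:R * f0 = pi / 2 ->
  \int[mu]_(r in `[0, M]) cos (r * x + s * r ^+ m) @[M --> +oo] -->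
  \int[mu]_(r in `[0, +oo[) (expR (- (sin f0 * x * r) - s * r ^+ m) *
     cos (f0 + cos f0 * x * r)).
Proof.
move=> m3 s0 mf0.
have pi0 := pi_gt0 R.
have m1R : 1 <= m%:R :> R by rewrite ler1n (leq_trans _ m3).
have f00 : 0 <= f0.
  by rewrite -(pmulr_rge0 _ (lt_le_trans ltr01 m1R)) mf0 divr_ge0// ltW.
(* Real and imaginary parts of the exponent at [z = r exp (i v)]; the summand [v] of [q] is the
   argument of [dz]. *)
pose p v r := - (x * r * sin v) - s * r ^+ m * sin (m%:R * v).
pose q v r := v + x * r * cos v + s * r ^+ m * cos (m%:R * v).
pose F (M v : R) := \int[mu]_(r in `[0, M]) (expR (p v r) * cos (q v r)).
pose k (M : R) := s * M / 2 - `|x|.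
(* On the arc the damping [s M ^ m sin (m v)] is at least [s M ^ 2 v / 2], while the linear term
   grows by at most [|x| M v]; [M * k M] is the resulting decay rate in [v]. *)
have pub M v : 1 <= M -> 0 <= v <= f0 -> p v M <= - (M * k M * v).
  move=> M1 /andP[v0 vf0].
  have M0 : 0 <= M by rewrite (le_trans ler01).
  have H1 : - (x * M * sin v) <= `|x| * M * v.
    rewrite (le_trans (ler_norm _))// normrN !normrM (ger0_norm M0).
    by rewrite ler_wpM2l ?mulr_ge0// sin_le_id.
  have H2 : m%:R * v / 2 <= sin (m%:R * v).
    apply: sin_ge_half; rewrite mulr_ge0//= -mf0 ler_wpM2l//.
  have H3 : v / 2 <= sin (m%:R * v).
    by apply: le_trans H2; rewrite ler_wpM2r// ler_peMl.
  have H4 : M ^+ 2 <= M ^+ m by rewrite ler_weXn2l// ltnW.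
  have H5 : M ^+ 2 * (v / 2) <= M ^+ m * sin (m%:R * v).
    by rewrite ler_pM// ?exprn_ge0// divr_ge0.
  have : s * (M ^+ 2 * (v / 2)) <= s * (M ^+ m * sin (m%:R * v)).
    by rewrite ler_wpM2l// ltW.
  by rewrite /p /k expr2; lra.
have key M : 1 <= M -> 0 < k M -> `|F M f0 - F M 0| <= (k M)^-1.
  move=> M1 kM.
  have M0 : 0 <= M by rewrite (le_trans ler01).
  pose p' v r := - (x * r * cos v) - s * r ^+ m * (m%:R * cos (m%:R * v)).
  pose q' v r := 1 - x * r * sin v - s * r ^+ m * (m%:R * sin (m%:R * v)).
  pose pu v r := - (x * sin v) - s * (m%:R * r ^+ m.-1) * sin (m%:R * v).
  pose qu v r := x * cos v + s * (m%:R * r ^+ m.-1) * cos (m%:R * v).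
  have rm (r : R) : r ^+ m = r * r ^+ m.-1 by rewrite -exprS prednK// (ltn_trans _ m3).
  have cp : continuous (fun z : R * R => p z.1 z.2) by rewrite /p; cnt.
  have cq : continuous (fun z : R * R => q z.1 z.2) by rewrite /q; cnt.
  have cp' : continuous (fun z : R * R => p' z.1 z.2) by rewrite /p'; cnt.
  have cq' : continuous (fun z : R * R => q' z.1 z.2) by rewrite /q'; cnt.
  have dF (v : R) : is_derive v 1 (F M)
    (0 * (expR (p v 0) * sin (q v 0)) - M * (expR (p v M) * sin (q v M))).
    apply: (@is_derive_contour_integral R p q p' q' pu qu (fun y => y) (fun=> 1) 0 M M0 _ _ _ _ _ _ _ cp cq cp' cq').
    + by move=> y u; rewrite /p /p'; der; ring.
    + by move=> y u; rewrite /q /q'; der; ring.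
    + by move=> y u; rewrite /p /pu; der; ring.
    + by move=> y u; rewrite /q /qu; der; ring.
    + by move=> y u; rewrite /p' /qu rm; ring.
    + by move=> y u; rewrite /q' /pu rm; ring.
  (* A primitive of the arc bound; between [0] and [f0] it increases by at most the inverse of
     [k M]. *)
  have dG (v : R) : is_derive v 1 (fun v => - ((k M)^-1 * expR (- (M * k M * v))))
      (M * expR (- (M * k M * v))).
    by der; field; rewrite gt_eqF.
  apply: le_trans (ler_derive_dist (F M) _ _ _ 0 f0 f00 dF dG _) _.
    move=> v v0; rewrite mul0r sub0r normrN !normrM (ger0_norm M0).
    rewrite ler_wpM2l// ger0_norm ?expR_ge0//.
    rewrite -[leRHS]mulr1 ler_pM ?expR_ge0 ?ler_expR ?pub//.
    by rewrite ler_norml sin_geN1 sin_le1.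
  rewrite mulr0 oppr0 expR0 mulr1 opprK gerDr oppr_le0 mulr_ge0 ?expR_ge0//.
  by rewrite invr_ge0 ltW.
rewrite (_ : \int[mu]_(r in `[0, +oo[) _ =
    \int[mu]_(r in `[0, +oo[) (expR (p f0 r) * cos (q f0 r))); last first.
  apply: eq_Rintegral => r _.
  rewrite /p /q mf0 cos_pihalf sin_pihalf mulr0 mulr1 addr0.
  have xrE c : x * r * c = c * x * r by ring.
  by rewrite !xrE.
have intf : mu.-integrable `[0, +oo[ (EFin \o (fun r => expR (p f0 r) * cos (q f0 r))).
  apply: (@integrable_powR_decay _ _ 1 `|x| s m%:R) => //.
  - by rewrite /p /q; msr.
  - by rewrite ltr1n ltnW.
  - move=> y y0; rewrite normrM ger0_norm ?expR_ge0// mulrC.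
    apply: ler_pM; rewrite ?expR_ge0//; first by rewrite ler_norml cos_geN1 cos_le1.
    rewrite ler_expR /p mf0 sin_pihalf mulr1 powR_mulrn// lerD2r.
    rewrite (le_trans (ler_norm _))// normrN !normrM (ger0_norm y0).
    by rewrite ler_piMr ?mulr_ge0// ler_norml sin_geN1 sin_le1.
(* The truncated cosine integral is [F M 0], written as the rotated integral minus the arc
   contribution. *)
rewrite (_ : (fun M => _) = (fun M => F M f0 - (F M f0 - F M 0))); last first.
  apply/funext => M; rewrite opprB addrC subrK /F /p /q.
  apply: eq_Rintegral => r _; rewrite sin0 !mulr0 sin0 mulr0 oppr0 addr0 expR0.
  by rewrite mul1r cos0 !mulr1 add0r mulrC.
rewrite -[X in _ --> X]subr0; apply: cvgB; first exact: cvg_Rintegral_itv0y.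
apply/cvgr0Pnorm_le => e e0.
near=> M.
have M1 : 1 <= M by near: M; exact: nbhs_pinfty_ge.
have kM : e^-1 <= k M.
  have : (e^-1 + `|x|) * 2 / s <= M by near: M; apply: nbhs_pinfty_ge; exact: num_real.
  by rewrite ler_pdivrMr// /k; lra.
have kM0 : 0 < k M by rewrite (lt_le_trans _ kM)// invr_gt0.
apply: le_trans (key M M1 kM0) _.
by rewrite -[leRHS]invrK lef_pV2 // posrE invr_gt0.
Unshelve. all: end_near. Qed.

Lemma pseudo_densityE (n : nat) (x s : R) : (1 <= n)%N -> 0 < s ->
  pseudo_density n x s = pi^-1 * \int[mu]_(r in `[0, +oo[)
    (expR (- (coef_b n * x * r) - s * r ^+ (2 * n + 1)) *
     cos (pi / (2 * (2 * n + 1)%:R) + coef_a n * x * r)).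
Proof.
move=> n1 s0; congr (_ * _); apply/cvg_lim => //.
apply: cvg_sector_rotation => //; first by lia.
have : (2 * n + 1)%:R != 0 :> R by rewrite pnatr_eq0 addn1.
by move: (2 * n + 1)%:R => m m0; field.
Qed.

End Sector.

(** * Expectations through a density *)

Section Density.
Context {R : realType} {d : measure_display} {T : measurableType d}.
Context {P : probability T R}.
Notation mu := (@lebesgue_measure R).
Notation pos := (`]0%R, +oo[%classic : set R).
Variables (X : {RV P >-> R}) (f : R -> R).
Hypothesis dX : has_density_on_pos X f.

Lemma density_measurable : measurable_fun setT (f \_ pos).
Proof. by case: dX => mf _ _; apply/(measurable_restrictT _ _).1. Qed.

Lemma density_ge0 y : 0 <= (f \_ pos) y.
Proof.
case: dX => _ f0 _; apply: restrict_ge0 => z /=.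
by rewrite in_itv/= andbT => /f0.
Qed.

Lemma distribution_density (A : set R) : measurable A ->
  distribution P X A = (\int[mu]_(y in A) ((f \_ pos) y)%:E)%E.
Proof.
case: dX => _ _ H mA; rewrite H// integral_mkcondr.
by apply: eq_integral => y _; rewrite !patchE; case: ifP.
Qed.

Lemma density_integrable : mu.-integrable setT (EFin \o (f \_ pos)).
Proof.
have mf := density_measurable.
apply/integrableP; split; first exact/measurable_EFinP.
under eq_integral => y _ do rewrite /= ger0_norm ?density_ge0//.
by rewrite -distribution_density// probability_setT ltry.
Qed.

(** The law of [X] is absolutely continuous with respect to Lebesgue measure. Its Radon-Nikodym
    derivative has the same integral as the given density over every measurable set, so the two
    agree almost everywhere. *)
Lemma ge0_expectation_density (g : R -> R) : measurable_fun setT g ->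
  (forall y, 0 <= g y) ->
  (\int[P]_w (g (X w))%:E = \int[mu]_y (g y * (f \_ pos) y)%:E)%E.
Proof.
move=> mg g0.
have mf := density_measurable.
have mX : measurable_fun setT (X : T -> measurableTypeR R).
  exact: (measurable_funPT X).
(* [X] is repackaged with values in the measurable type on which Lebesgue measure lives. *)
pose X' : {mfun T >-> measurableTypeR R} :=
  HB.pack (X : T -> measurableTypeR R) (isMeasurableFun.Build _ _ _ _ _ mX).
pose nu : {finite_measure set (measurableTypeR R) -> \bar R} := distribution P X'.
pose la : {sigma_finite_measure set (measurableTypeR R) -> \bar R} := mu.
have nuE A : measurable A -> nu A = (\int[la]_(y in A) ((f \_ pos) y)%:E)%E.
  exact: distribution_density.
have dom : nu `<< la.
  apply/null_content_dominatesP => A mA A0.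
  rewrite nuE//; apply: null_set_integral => //.
  by apply/measurable_EFinP; exact: measurable_funTS.
have mEg : measurable_fun setT (EFin \o g) by exact/measurable_EFinP.
rewrite -[LHS](@ge0_integral_distribution _ _ _ _ _ _ X' (EFin \o g))//.
rewrite -(@Radon_Nikodym_SigmaFinite.change_of_variables _ _ _ nu la dom)//.
have mRN := measurable_int _ (Radon_Nikodym_SigmaFinite.f_integrable dom).
apply: ae_eq_integral => //.
- exact: emeasurable_funM.
- exact/measurable_EFinP/measurable_funM.
under [X in ae_eq _ _ _ X]eq_fun do rewrite EFinM.
apply: ae_eqe_mul2l.
apply: ae_eq_sym.
apply: integral_ae_eq => //; first exact: density_integrable.
move=> E _ mE.
by rewrite -Radon_Nikodym_SigmaFinite.f_integral// nuE.
Qed.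

(** Positive and negative parts are treated separately; the nonnegative density factors out of
    each. *)
Lemma expectation_density (g : R -> R) : measurable_fun setT g ->
  ('E_P[fun w => g (X w)] = \int[mu]_y (g y * (f \_ pos) y)%:E)%E.
Proof.
move=> mg; rewrite unlock integralE [RHS]integralE.
congr (_ - _)%E.
- transitivity (\int[P]_w (Num.max (g (X w)) 0)%:E)%E.
    by apply: eq_integral => w _; rewrite funeposE EFin_max.
  rewrite (@ge0_expectation_density (fun y => Num.max (g y) 0)).
  + apply: eq_integral => y _; rewrite funeposE -EFin_max.
    by rewrite maxr_pMl ?density_ge0// mul0r.
  + exact: measurable_maxr.
  + by move=> y; rewrite le_max lexx orbT.
- transitivity (\int[P]_w (Num.max (- g (X w)) 0)%:E)%E.
    by apply: eq_integral => w _; rewrite funenegE EFin_max.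
  rewrite (@ge0_expectation_density (fun y => Num.max (- g y) 0)).
  + apply: eq_integral => y _; rewrite funenegE -EFinN -EFin_max.
    by rewrite maxr_pMl ?density_ge0// mul0r mulNr.
  + by apply: measurable_maxr => //; exact: measurable_funN.
  + by move=> y; rewrite le_max lexx orbT.
Qed.

End Density.

(** * Fubini's theorem for real-valued integrals *)

Section FubiniReal.
Context {d1 d2 : measure_display} {T1 : measurableType d1} {T2 : measurableType d2}.
Context {R : realType}.
Variables (m1 : {sigma_finite_measure set T1 -> \bar R})
          (m2 : {sigma_finite_measure set T2 -> \bar R}).
Variable F : T1 * T2 -> R.
Hypothesis mF : measurable_fun setT F.

Lemma measurable_section1 x : measurable_fun setT (fun y => F (x, y)).
Proof. exact: (measurableT_comp mF (pair1_measurable x)). Qed.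

Lemma measurable_section2 y : measurable_fun setT (fun x => F (x, y)).
Proof. exact: (measurableT_comp mF (pair2_measurable y)). Qed.

(** A product of integrable functions of separate variables is an integrable majorant, by Tonelli.
    It also controls every section, not only almost every one. *)
Lemma integrable_prod_dominated (a : T1 -> R) (b : T2 -> R) :
  m1.-integrable setT (EFin \o a) -> m2.-integrable setT (EFin \o b) ->
  (forall x y, `|F (x, y)| <= `|a x| * `|b y|) ->
  [/\ (m1 \x m2)%E.-integrable setT (EFin \o F),
      forall x, m2.-integrable setT (EFin \o (fun y => F (x, y))) &
      forall y, m1.-integrable setT (EFin \o (fun x => F (x, y)))].
Proof.
move=> ia ib Fab.
have ma : measurable_fun setT a by apply/measurable_EFinP; case/integrableP: ia.
have mb : measurable_fun setT b by apply/measurable_EFinP; case/integrableP: ib.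
have int1 x : m2.-integrable setT (EFin \o (fun y => F (x, y))).
  apply: (@integrable_dominated _ _ _ m2 _ _ (fun y => `|a x| * `|b y|)) => //.
    exact: measurable_section1.
  by apply: integrable_mull => //; exact: integrable_norm.
have int2 y : m1.-integrable setT (EFin \o (fun x => F (x, y))).
  apply: (@integrable_dominated _ _ _ m1 _ _ (fun x => `|b y| * `|a x|)) => //.
    exact: measurable_section2.
    by move=> x _; rewrite mulrC.
  by apply: integrable_mull => //; exact: integrable_norm.
split=> //.
have mEF : measurable_fun setT (EFin \o F) by exact/measurable_EFinP.
apply/(integrable12ltyP _ _ mEF).
apply: (@le_lt_trans _ _ (\int[m1]_x (`|a x|%:E * \int[m2]_y `|b y|%:E))%E).
  apply: ge0_le_integral => //.
  - by move=> x _; exact: integral_ge0.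
  - apply: (measurable_fun_fubini_tonelli_F (abse \o (EFin \o F))) => //=.
    exact: measurableT_comp.
  - apply: emeasurable_funM => //.
    by apply/measurable_EFinP; exact: measurableT_comp.
  - move=> x _; rewrite -ge0_integralZl//.
    + apply: ge0_le_integral => //.
      * by do 2 apply: measurableT_comp => //; exact: measurable_section1.
      * apply/measurable_EFinP; apply: measurable_funM => //.
        exact: measurableT_comp.
      * by move=> y _; rewrite -EFinM lee_fin.
    + by apply/measurable_EFinP; exact: measurableT_comp.
have bfin : (\int[m2]_y `|b y|%:E)%E \is a fin_num.
  by apply: integrable_fin_num => //; exact: integrable_norm.
rewrite -(fineK bfin).
rewrite ge0_integralZr//.
- apply: lte_mul_pinfty => //.
    by apply: integral_ge0.
    by apply: integrable_fin_num => //; exact: integrable_norm.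
  by rewrite ltry.
- by apply/measurable_EFinP; exact: measurableT_comp.
- by rewrite lee_fin fine_ge0// integral_ge0.
Qed.

Hypothesis iF : (m1 \x m2)%E.-integrable setT (EFin \o F).
Hypothesis int1 : forall x, m2.-integrable setT (EFin \o (fun y => F (x, y))).
Hypothesis int2 : forall y, m1.-integrable setT (EFin \o (fun x => F (x, y))).

(** Every section is integrable, so [fine] loses nothing and the real inner integral is the
    extended-real one at each point. *)
Let inner1 : (fun x => (\int[m2]_y F (x, y))%:E) = fubini_F m2 (EFin \o F).
Proof.
apply/funext => x; rewrite /fubini_F /Rintegral fineK//.
apply: integrable_fin_num => //; exact: int1.
Qed.

Let inner2 : (fun y => (\int[m1]_x F (x, y))%:E) = fubini_G m1 (EFin \o F).
Proof.
apply/funext => x; rewrite /fubini_G /Rintegral fineK//.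
apply: integrable_fin_num => //; exact: int2.
Qed.

Lemma measurable_Rintegral1 : measurable_fun setT (fun x => \int[m2]_y F (x, y)).
Proof.
apply/measurable_EFinP; rewrite [X in measurable_fun _ X]inner1.
exact: measurable_fubini_F iF.
Qed.

Lemma integrable_Rintegral1 :
  m1.-integrable setT (EFin \o (fun x => \int[m2]_y F (x, y))).
Proof.
rewrite (_ : EFin \o _ = fubini_F m2 (EFin \o F)); last by rewrite -inner1.
exact: integrable_fubini_F iF.
Qed.

Lemma Fubini_EFin :
  (\int[m1]_x (\int[m2]_y F (x, y))%:E = \int[m2]_y (\int[m1]_x F (x, y))%:E)%E.
Proof.
transitivity (\int[m1]_x fubini_F m2 (EFin \o F) x)%E; first by rewrite -inner1.
transitivity (\int[m2]_x fubini_G m1 (EFin \o F) x)%E; last by rewrite -inner2.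
by rewrite integral12_prod_meas1// -integral21_prod_meas1.
Qed.

End FubiniReal.

(** * From the characteristic function to the Laplace transform *)

Section Laplace.
Context {R : realType}.
Notation mu := (@lebesgue_measure R).
Notation mR := (measurableTypeR R).

(** For [C = c l ^ alpha] and [b = alpha s], this tests [exp (- c z ^ alpha)] along
    [z = l exp (s u)] against the Gaussian. *)
Let J (C b : R) := \int[mu]_u expR (- u ^+ 2 - C * expR (b * u)).

(** Dominated convergence with the Gaussian as majorant: the inner exponential tends to [1]. The
    factor [b] covers both scales that occur, [1] and [theta]. *)
Lemma cvg_gauss_exp_scale (C b : R) : 0 <= C ->
  \int[mu]_u expR (- u ^+ 2 - C * expR (b * k.+1%:R^-1 * u)) @[k --> \oo] -->
  expR (- C) * \int[mu]_u gauss_fun u.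
Proof.
move=> C0; have iG := @integrableT_gauss R.
rewrite -RintegralZl//.
apply: (@cvg_Rintegral_dominated _ _ _ mu _ _ _ (@gauss_fun R)) => //.
- by move=> n; msr.
- move=> u _; pose p z := expR (- u ^+ 2 - C * expR (z * u)).
  have cp : continuous p by rewrite /p; cnt.
  have -> : expR (- C) * gauss_fun u = p 0.
    by rewrite /p mul0r expR0 mulr1 addrC expRD.
  apply: (@cvg_comp _ _ _ (fun k : nat => b * k.+1%:R^-1) p _ (nbhs (0 : R))).
    have bk : b * k.+1%:R^-1 @[k --> \oo] --> b * 0.
      by apply: cvgMl_tmp; exact: cvg_harmonic.
    by rewrite mulr0 in bk.
  exact: cp.
- move=> n u _; rewrite ger0_norm ?expR_ge0// ler_expR gerDl oppr_le0.
  by rewrite mulr_ge0 ?expR_ge0.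
Qed.

Variables (H : R -> R) (t theta : R).
Hypothesis mH : measurable_fun setT H.
Hypothesis H0 : forall y, 0 <= H y.
Hypothesis Hs : forall y, y <= 0 -> H y = 0.
Hypothesis iH : mu.-integrable setT (EFin \o H).
Hypothesis t0 : 0 <= t.
Hypothesis theta01 : 0 < theta < 1.
(** [charC] and [charS] are the real and imaginary parts of the characteristic function [exp (- t g
    ^ theta exp (- i theta pi / 2))]. *)
Hypothesis charC : forall g, 0 < g -> \int[mu]_y (cos (g * y) * H y) =
  expR (- (t * g `^ theta * cos (theta * (pi / 2)))) *
  cos (t * g `^ theta * sin (theta * (pi / 2))).
Hypothesis charS : forall g, 0 < g -> \int[mu]_y (sin (g * y) * H y) =
  expR (- (t * g `^ theta * cos (theta * (pi / 2)))) *
  sin (t * g `^ theta * sin (theta * (pi / 2))).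

Let integrable_trigH (k : R -> R) : measurable_fun setT k ->
  (forall y, `|k y| <= 1) -> mu.-integrable setT (EFin \o (fun y => k y * H y)).
Proof.
move=> mk k1; apply: (@integrable_dominated _ _ _ mu _ _ H) => //.
  exact: measurable_funM.
by move=> y _; rewrite normrM (ger0_norm (H0 y)) ler_piMl.
Qed.

(* Both sides are shifted to the imaginary axis, where the left-hand side only
   involves the characteristic function. *)
Lemma laplace_mixture (l s : R) : 0 < l -> 0 < s ->
  \int[mu]_y (H y * J (l * `|y|) s) = J (t * l `^ theta) (theta * s).
Proof.
move=> l0 s0.
have [th0 th1] := andP theta01.
have pi0 := pi_gt0 R.
(* With [s v = pi / 2] the shift multiplies [l exp (s u)] by [i]. On the right-hand side the angle
   is [theta s v], still at most [pi / 2] since [theta < 1]. *)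
pose v := pi / 2 / s.
have sv : s * v = pi / 2 by rewrite /v; field; rewrite gt_eqF.
have v0 : 0 <= v by rewrite !divr_ge0 ?ltW.
pose b u : R := expR (v ^+ 2) * gauss_fun u.
pose q (z : mR * mR) := cos (2 * z.2 * v + l * `|z.1| * expR (s * z.2)).
(* The shifted integrand of the left-hand side, whose damping is gone because [cos (s v) = 0]. The
   absolute value keeps the coefficient nonnegative for all [y], and [H] vanishes where it differs
   from [y]. *)
pose F (z : mR * mR) := H z.1 * (expR (v ^+ 2 - z.2 ^+ 2) * q z).
have bE u : expR (v ^+ 2 - u ^+ 2) = b u by rewrite expRD.
have b0 u : 0 <= b u by rewrite mulr_ge0 ?expR_ge0.
have ib : mu.-integrable setT (EFin \o b).
  by apply: integrable_mull => //; exact: integrableT_gauss.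
have mF : measurable_fun setT F.
  rewrite /F /q; apply: measurable_funM; last by msr.
  exact: (measurableT_comp mH measurable_fst).
have q1 z : `|q z| <= 1 by rewrite ler_norml cos_geN1 cos_le1.
have Fab (y u : mR) : `|F (y, u)| <= `|H y| * `|b u|.
  by rewrite /F /= normrM ler_wpM2l// bE normrM ler_piMr.
pose la : {sigma_finite_measure set mR -> \bar R} := mu.
have [iF i1 i2] := @integrable_prod_dominated _ _ _ _ R la la F mF H b iH ib Fab.
have E1 (y : mR) : \int[la]_u F (y, u) = H y * J (l * `|y|) s.
  rewrite /F /= RintegralZl//.
    congr (_ * _); rewrite [RHS](gauss_contour_shift _ _ v)//; last 3 first.
    + by rewrite mulr_ge0// ltW.
    + exact: ltW.
    + by rewrite sv.
    by apply: eq_Rintegral => u _; rewrite sv cos_pihalf sin_pihalf mulr0 subr0 mulr1.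
  apply: (@integrable_dominated _ _ _ mu _ _ b) => //; first by rewrite /q /=; msr.
  by move=> u _; rewrite /= bE normrM ger0_norm// ler_piMr.
have E2 (u : mR) : \int[la]_y F (y, u) =
    expR (v ^+ 2 - u ^+ 2 - t * l `^ theta * expR (theta * s * u) * cos (theta * s * v)) *
    cos (2 * u * v + t * l `^ theta * expR (theta * s * u) * sin (theta * s * v)).
  pose g := l * expR (s * u).
  have g0 : 0 < g by rewrite mulr_gt0 ?expR_gt0.
  have gE : t * l `^ theta * expR (theta * s * u) = t * g `^ theta.
    by rewrite /g powRM ?expR_ge0 ?(ltW l0)// -expRM -mulrA; congr (_ * (_ * expR _)); ring.
  rewrite gE -[theta * s * v]mulrA sv.
  (* The addition formula isolates [cos (g y)] and [sin (g y)], that is, the characteristic function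
     at [g = l exp (s u)]. *)
  transitivity (\int[mu]_y (b u * cos (2 * u * v) * (cos (g * y) * H y) -
                            b u * sin (2 * u * v) * (sin (g * y) * H y))).
    apply: eq_Rintegral => y _; rewrite /F /q /= bE.
    have [y0|y0] := leP y 0; first by rewrite Hs// !mulr0 mul0r subr0.
    rewrite (gtr0_norm y0) (_ : l * y * expR (s * u) = g * y) ?cosD; last by rewrite /g; ring.
    by ring.
  have iC : mu.-integrable setT (EFin \o (fun y => cos (g * y) * H y)).
    apply: integrable_trigH; first by msr.
    by move=> y; rewrite ler_norml cos_geN1 cos_le1.
  have iS : mu.-integrable setT (EFin \o (fun y => sin (g * y) * H y)).
    apply: integrable_trigH; first by msr.
    by move=> y; rewrite ler_norml sin_geN1 sin_le1.
  rewrite RintegralB//; try exact: integrable_mull.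
  rewrite !RintegralZl// charC// charS// -bE [in RHS]expRD cosD.
  by ring.
transitivity (fine (\int[la]_y (\int[la]_u F (y, u))%:E)%E).
  by apply: eq_Rintegral => y _; rewrite E1.
rewrite Fubini_EFin// [RHS](gauss_contour_shift _ _ v); last 4 first.
- by rewrite mulr_ge0// powR_ge0.
- by rewrite mulr_ge0// ltW.
- exact: v0.
- by rewrite -mulrA sv ler_piMl// ?divr_ge0// ltW.
by apply: eq_Rintegral => u _; rewrite E2.
Qed.

(** Take [s = 1 / (k + 1)] in [laplace_mixture] and let [k] grow: both sides tend to the desired
    quantities times the Gaussian integral [c], which is positive and cancels. *)
Lemma laplace_transform (l : R) : 0 < l ->
  \int[mu]_y (H y * expR (- (l * y))) = expR (- (t * l `^ theta)).
Proof.
move=> l0; have iG := @integrableT_gauss R.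
pose c : R := \int[mu]_u gauss_fun u.
have c0 : 0 < c by rewrite /c /Rintegral integralT_gauss /= sqrtr_gt0 pi_gt0.
pose la : {sigma_finite_measure set mR -> \bar R} := mu.
pose f_ (k : nat) y := H y * J (l * `|y|) k.+1%:R^-1.
have ly (y : R) : 0 <= l * `|y| by rewrite mulr_ge0// ltW.
have J1 C b : 0 <= C -> mu.-integrable setT
    (EFin \o (fun u => expR (- u ^+ 2 - C * expR (b * u)))).
  move=> C0; apply: (@integrable_dominated _ _ _ mu _ _ (@gauss_fun R)) => //.
    by msr.
  move=> u _; rewrite ger0_norm ?expR_ge0// ler_expR gerDl oppr_le0.
  by rewrite mulr_ge0 ?expR_ge0.
(* [J] depends on [y] as a parameter integral, so measurability comes from Fubini. *)
have mf k : measurable_fun setT (f_ k).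
  pose F (z : mR * mR) := H z.1 *
    expR (- z.2 ^+ 2 - l * `|z.1| * expR (k.+1%:R^-1 * z.2)).
  have mF : measurable_fun setT F.
    rewrite /F; apply: measurable_funM; last by msr.
    exact: (measurableT_comp mH measurable_fst).
  have Fab (y u : mR) : `|F (y, u)| <= `|H y| * `|gauss_fun u|.
    rewrite /F /= normrM ler_wpM2l// /gauss_fun [leLHS]ger0_norm ?expR_ge0//
      [leRHS]ger0_norm ?expR_ge0// ler_expR gerDl oppr_le0.
    by rewrite mulr_ge0 ?expR_ge0.
  have [iF i1 i2] := @integrable_prod_dominated _ _ _ _ R la la F mF H _ iH iG Fab.
  rewrite (_ : f_ k = fun y => \int[la]_u F (y, u)).
    exact: (measurable_Rintegral1 la la F iF i1).
  apply/funext => y; rewrite /F /= RintegralZl//; exact: J1.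
have lim1 : \int[mu]_y f_ k y @[k --> \oo] --> \int[mu]_y (c * (H y * expR (- (l * y)))).
  apply: (@cvg_Rintegral_dominated _ _ _ mu _ _ _ (fun y => c * H y)) => //.
  - move=> y _; rewrite /f_.
    have [y0|y0] := leP y 0.
      by rewrite Hs// !(mul0r, mulr0); under eq_cvg do rewrite mul0r; exact: cvg_cst.
    rewrite [X in _ --> X](_ : _ = H y * (expR (- (l * `|y|)) * c)); last first.
      by rewrite (gtr0_norm y0); ring.
    apply: cvgMl_tmp.
    have -> : (fun k => J (l * `|y|) k.+1%:R^-1) = fun k =>
        \int[mu]_u expR (- u ^+ 2 - l * `|y| * expR (1 * k.+1%:R^-1 * u)).
      by apply/funext => k; rewrite mul1r.
    exact: cvg_gauss_exp_scale (ly y).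
  - move=> k y _; rewrite /f_ normrM (ger0_norm (H0 y)) mulrC ler_wpM2r//.
    rewrite ger0_norm; last by apply: Rintegral_ge0 => u _; exact: expR_ge0.
    apply: le_Rintegral => //; first exact: J1.
    move=> u _; rewrite ler_expR gerDl oppr_le0.
    by rewrite mulr_ge0 ?expR_ge0.
  - exact: integrable_mull.
have lim2 : \int[mu]_y f_ k y @[k --> \oo] --> expR (- (t * l `^ theta)) * c.
  rewrite (_ : (fun k => _) = (fun k => J (t * l `^ theta) (theta * k.+1%:R^-1))).
    by apply: cvg_gauss_exp_scale; rewrite mulr_ge0 ?powR_ge0.
  by apply/funext => k; rewrite laplace_mixture// invr_gt0.
have := cvg_unique (@Rhausdorff R) lim1 lim2.
rewrite RintegralZl//; last first.
  apply: (@integrable_dominated _ _ _ mu _ _ H) => //.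
    by apply: measurable_funM => //; msr.
  move=> y _; have [y0|y0] := leP y 0; first by rewrite Hs// mul0r normr0.
  rewrite normrM !ger0_norm ?expR_ge0// ler_piMr// -expR0 ler_expR oppr_le0.
  by rewrite mulr_ge0 ?ltW.
move=> E; apply: (mulfI (lt0r_neq0 c0)).
by rewrite E mulrC.
Qed.

End Laplace.

(** * Integration by parts *)

Section GammaExpectation.
Context {R : realType}.
Notation mu := (@lebesgue_measure R).
Notation pos := (`]0%R, +oo[%classic : set R).

Lemma is_derive_powR_comp (f : R -> R) (p x a : R) : 0 < f x -> is_derive x 1 f a ->
  is_derive x 1 (fun y => f y `^ p) (p * f x `^ (p - 1) * a).
Proof.
move=> fx0 fa; apply: (is_derive_compR (fun z => z `^ p) f) => //.
exact: is_derive1_powR.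
Qed.

Lemma measurable_pos : measurable (pos : set (measurableTypeR R)).
Proof. exact: measurable_itv. Qed.

Lemma integrable_pos (f : R -> R) : mu.-integrable `[0, +oo[ (EFin \o f) ->
  mu.-integrable pos (EFin \o f).
Proof.
apply: integrableS => //.
by move=> y /=; rewrite !in_itv/= !andbT => /ltW.
Qed.

(** From [y <= 1 + y <= exp y]. It absorbs the factor [y ^ (g - 1)] into the linear part of an
    exponent. *)
Lemma powR_le_expR (y p : R) : 0 <= y -> 0 <= p -> y `^ p <= expR (p * y).
Proof.
move=> y0 p0; rewrite mulrC expRM; apply: ge0_ler_powR; rewrite ?nnegrE ?expR_ge0//.
by rewrite (le_trans _ (expR_ge1Dx y))// lerDr.
Qed.

(** Real powers are differentiated on the open half-line only. The derivative [f'] certifies that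
    [f] is continuous. *)
Lemma Rintegral_FTC_pos (F f f' : R -> R) (u v : R) : 0 < u -> u <= v ->
  (forall y : R, 0 < y -> is_derive y 1 F (f y)) ->
  (forall y : R, 0 < y -> is_derive y 1 f (f' y)) ->
  \int[mu]_(y in `[u, v]) f y = F v - F u.
Proof.
move=> u0; rewrite le_eqVlt => /predU1P[<-|uv] dF df.
  by rewrite set_itv1 Rintegral_set1 subrr.
have cont (k k' : R -> R) : (forall y : R, 0 < y -> is_derive y 1 k (k' y)) ->
    forall y, 0 < y -> {for y, continuous k}.
  move=> dk y y0; apply/differentiable_continuous/derivable1_diffP.
  by case: (dk y y0).
rewrite /Rintegral (@continuous_FTC2 _ f F)//.
- apply: continuous_in_subspaceT => y; rewrite inE/= in_itv/= => /andP[uy _].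
  exact: (cont _ _ df _ (lt_le_trans u0 uy)).
- split=> [y| |].
  + by rewrite in_itv/= => /andP[uy _]; case: (dF y (lt_trans u0 uy)).
  + exact/cvg_at_right_filter/(cont _ _ dF).
  + exact/cvg_at_left_filter/(cont _ _ dF _ (lt_trans u0 uv)).
- move=> y; rewrite in_itv/= => /andP[uy _].
  by rewrite derive1E; case: (dF y (lt_trans u0 uy)) => _ ->.
Qed.

Lemma expRN_cvg0 : expR (- n.+1%:R) @[n --> \oo] --> (0 : R).
Proof.
have := (@cvg_pinftyP R (fun z => expR (- z)) 0).1 (@cvgr_expR R).
apply; apply/cvgryPge => A; near=> n.
rewrite (@le_trans _ _ n%:R)// ?ler_nat//.
by near: n; exact: nbhs_infty_ger.
Unshelve. all: end_near. Qed.

Variables (g t x f0 : R).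
Hypothesis g1 : 1 < g.
Hypothesis t0 : 0 < t.

(** The modulus on the rotated ray: [g] is [m] before averaging over the subordinator and [theta m]
    after it. *)
Let wave y := expR (- (sin f0 * x * y) - t * y `^ g).

Let wave_le y : 0 <= y -> wave y <= expR (`|x| * y - t * y `^ g).
Proof.
move=> y0; rewrite ler_expR lerD2r (le_trans (ler_norm _))// normrN !normrM.
by rewrite (ger0_norm y0) ler_wpM2r// ler_piMl// ler_norml sin_geN1 sin_le1.
Qed.

Lemma integrable_damped_cos :
  mu.-integrable pos (EFin \o (fun y => wave y * cos (f0 + cos f0 * x * y))).
Proof.
apply/integrable_pos/(@integrable_powR_decay _ _ 1 `|x| t g) => //.
  by rewrite /wave; msr.
move=> y y0; rewrite normrM ger0_norm ?expR_ge0// mulrC.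
by apply: ler_pM; rewrite ?expR_ge0 ?wave_le// ler_norml cos_geN1 cos_le1.
Qed.

Lemma integrable_damped_sin : mu.-integrable pos (EFin \o (fun y =>
  wave y * sin (cos f0 * x * y) * (g * t * y `^ (g - 1)))).
Proof.
have g0 : 0 < g by rewrite (lt_trans ltr01).
apply/integrable_pos/(@integrable_powR_decay _ _ (g * t) (`|x| + (g - 1)) t g) => //.
- by rewrite /wave; msr.
- by rewrite addr_ge0// subr_ge0 ltW.
move=> y y0; rewrite !normrM ger0_norm ?expR_ge0// (gtr0_norm g0) (gtr0_norm t0).
rewrite (ger0_norm (powR_ge0 _ _)) [leLHS]mulrCA.
apply: ler_wpM2l; first by rewrite mulr_ge0// ltW.
rewrite (_ : (_ + _) * y - _ = `|x| * y - t * y `^ g + (g - 1) * y); last by ring.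
rewrite expRD; apply: ler_pM; rewrite ?mulr_ge0 ?expR_ge0 ?powR_ge0//.
  rewrite -[leRHS]mulr1; apply: ler_pM; rewrite ?expR_ge0 ?wave_le//.
  by rewrite ler_norml sin_geN1 sin_le1.
by rewrite powR_le_expR// subr_ge0 ltW.
Qed.

(* The boundary terms of [wave y * sin (cos f0 * x * y)]
   vanish at [0] and [+oo], and [cos (f0 + v) = cos f0 cos v - sin f0 sin v]. *)
Lemma damped_by_parts :
  \int[mu]_(y in pos) (wave y * sin (cos f0 * x * y) * (g * t * y `^ (g - 1))) =
  x * \int[mu]_(y in pos) (wave y * cos (f0 + cos f0 * x * y)).
Proof.
pose F y := wave y * sin (cos f0 * x * y).
pose f y := x * (wave y * cos (f0 + cos f0 * x * y)) -
  wave y * sin (cos f0 * x * y) * (g * t * y `^ (g - 1)).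
have dF (y : R) : 0 < y -> is_derive y 1 F (f y).
  move=> y0; have dp : is_derive y 1 (fun z => z `^ g) (g * y `^ (g - 1) * 1).
    by apply: is_derive_powR_comp => //; exact: is_derive_idR.
  by rewrite /F /f /wave; der; rewrite cosD; ring.
have [f' df] : exists f', forall y : R, 0 < y -> is_derive y 1 f (f' y).
  eexists => y y0; have dp p : is_derive y 1 (fun z => z `^ p) (p * y `^ (p - 1) * 1).
    by apply: is_derive_powR_comp => //; exact: is_derive_idR.
  by rewrite /f /wave; der0.
(* These intervals exhaust the open half-line while avoiding [0]. *)
pose D (n : nat) := `[n.+1%:R^-1, n.+1%:R]%classic : set R.
have i1 := integrable_damped_cos.
have i2 := integrable_damped_sin.
have i1x := integrable_mull mu pos x _ measurable_pos i1.
have lim1 : \int[mu]_(y in D n) f y @[n --> \oo] --> \int[mu]_(y in pos) f y.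
  apply: cvg_Rintegral_exhaust.
  - exact: measurable_pos.
  - by move=> n; exact: measurable_itv.
  - by move=> n y; rewrite /D /= !in_itv/= andbT => /andP[ny _]; rewrite (lt_le_trans _ ny)// invr_gt0.
  - move=> y /=; rewrite in_itv/= andbT => y0; near=> n; rewrite /D /= in_itv/=.
    have H z : z <= n%:R -> z <= n.+1%:R :> R by move/le_trans; apply; rewrite ler_nat.
    apply/andP; split.
      rewrite -[leRHS]invrK lef_pV2 ?posrE ?invr_gt0//.
      by apply: H; near: n; exact: nbhs_infty_ger.
    by apply: H; near: n; exact: nbhs_infty_ger.
  - exact: (@integrableB _ _ _ mu pos measurable_pos _ _ i1x i2).
have [K HK] := linear_powR_bound `|x| t g (normr_ge0 x) t0 g1.
(* Two bounds for the boundary term: exponential decay for the end at infinity, then a linear bound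
   for the end at [0]. *)
have Fle y : 0 <= y -> `|F y| <= expR K * expR (- y).
  move=> y0; rewrite /F normrM ger0_norm ?expR_ge0// -expRD -[leRHS]mulr1.
  apply: ler_pM; rewrite ?expR_ge0//; last by rewrite ler_norml sin_geN1 sin_le1.
  by rewrite (le_trans (wave_le y y0))// ler_expR HK.
have Fle0 y : 0 <= y -> `|F y| <= expR K * `|x| * y.
  move=> y0; rewrite /F normrM ger0_norm ?expR_ge0// -[leRHS]mulrA.
  apply: ler_pM; rewrite ?expR_ge0//.
    rewrite (le_trans (wave_le y y0))// ler_expR (le_trans (HK y y0))//.
    by rewrite gerBl.
  have [x0|x0] := leP 0 (cos f0 * x * y).
    rewrite (le_trans (sin_le_id _ x0))// (le_trans (ler_norm _))// !normrM.
    by rewrite (ger0_norm y0) ler_wpM2r// ler_piMl// ler_norml cos_geN1 cos_le1.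
  rewrite -normrN -sinN (le_trans (sin_le_id _ _)) ?oppr_ge0 ?(ltW x0)//.
  rewrite (le_trans (ler_norm _))// normrN !normrM.
  by rewrite (ger0_norm y0) ler_wpM2r// ler_piMl// ler_norml cos_geN1 cos_le1.
have lim2 : \int[mu]_(y in D n) f y @[n --> \oo] --> (0 : R).
  have E n : \int[mu]_(y in D n) f y = F n.+1%:R - F n.+1%:R^-1.
    rewrite /D (Rintegral_FTC_pos F f f')// ?invr_gt0//.
    by rewrite (@le_trans _ _ 1)// ?invf_le1 ?ler1n.
  under eq_fun do rewrite E.
  suff : F n.+1%:R - F n.+1%:R^-1 @[n --> \oo] --> (0 - 0 : R) by rewrite subr0.
  apply: cvgB; apply: norm_cvg0.
  - apply: (@squeeze_cvgr _ _ _ _ (cst 0) (fun n => expR K * expR (- n.+1%:R))).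
    + by near=> n; rewrite normr_ge0/= Fle.
    + exact: cvg_cst.
    + suff : expR K * expR (- n.+1%:R) @[n --> \oo] --> expR K * 0 by rewrite mulr0.
      by apply: cvgMl_tmp; exact: expRN_cvg0.
  - apply: (@squeeze_cvgr _ _ _ _ (cst 0) (fun n => expR K * `|x| * n.+1%:R^-1)).
    + by near=> n; rewrite normr_ge0/= Fle0// invr_ge0.
    + exact: cvg_cst.
    + suff : expR K * `|x| * n.+1%:R^-1 @[n --> \oo] --> expR K * `|x| * 0.
        by rewrite mulr0.
      by apply: cvgMl_tmp; exact: cvg_harmonic.
have := cvg_unique (@Rhausdorff R) lim1 lim2; rewrite /f.
rewrite (RintegralB measurable_pos i1x i2) (RintegralZl x measurable_pos i1).
move=> E; apply/esym/subr0_eq; exact: E.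
Unshelve. all: end_near. Qed.

End GammaExpectation.

(** * Superposition of pseudo-densities *)

Section Superposition.
Context {R : realType}.
Notation mu := (@lebesgue_measure R).
Notation mR := (measurableTypeR R).
Notation pos := (`]0%R, +oo[%classic : set R).
Variables (H : R -> R) (m : nat) (f0 x t theta : R).
Hypothesis mH : measurable_fun setT H.
Hypothesis H0 : forall y, 0 <= H y.
Hypothesis Hs : forall y, y <= 0 -> H y = 0.
Hypothesis iH : mu.-integrable setT (EFin \o H).
Hypothesis t0 : 0 < t.
Hypothesis m1 : (1 < m)%N.
Hypothesis thetam : 1 < theta * m%:R.
Hypothesis laplaceH : forall l, 0 < l ->
  \int[mu]_y (H y * expR (- (l * y))) = expR (- (t * l `^ theta)).

(** Fubini in [r] and [s]. Integrating in [s] first gives the Laplace transform of [H] at [r ^ m],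
    hence damping by [t r ^ (theta m)], integrable in [r] because [theta m > 1]. *)
Lemma laplace_superposition (A : R -> R) :
  (forall s, 0 < s -> A s = \int[mu]_(r in pos)
     (expR (- (sin f0 * x * r) - s * r `^ m%:R) * cos (f0 + cos f0 * x * r))) ->
  mu.-integrable setT (EFin \o (fun s => A s * H s)) /\
  (\int[mu]_s (A s * H s)%:E = (\int[mu]_(r in pos)
     (expR (- (sin f0 * x * r) - t * r `^ (theta * m%:R)) *
      cos (f0 + cos f0 * x * r)))%:E)%E.
Proof.
move=> AE.
pose la : {sigma_finite_measure set mR -> \bar R} := mu.
have mpos := @measurable_pos R.
have m1R : 1 < m%:R :> R by rewrite ltr1n.
pose k s p r := expR (- (sin f0 * x * r) - s * r `^ p) * cos (f0 + cos f0 * x * r).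
pose e r := expR (- (sin f0 * x * r)) * cos (f0 + cos f0 * x * r).
pose E := e \_ pos.
have ik s p : 1 < p -> 0 < s -> mu.-integrable setT (EFin \o (k s p \_ pos)).
  move=> p1 s0; rewrite -restrict_EFin; apply/(integrable_mkcond _ mpos).
  exact: integrable_damped_cos.
have mE : measurable_fun setT E.
  by apply/(measurable_restrictT _ _).1 => //; rewrite /e; msr.
(* A joint integrand on the whole plane: [E] and [H] vanish on the nonpositive axes, and [|z.1|]
   agrees with [z.1] where [H] can be nonzero. *)
pose F (z : mR * mR) := H z.1 * (E z.2 * expR (- (`|z.1| * z.2 ^+ m))).
have mF : measurable_fun setT F.
  rewrite /F; apply: measurable_funM; first exact: (measurableT_comp mH measurable_fst).
  apply: measurable_funM; last by msr.
  exact: (measurableT_comp mE measurable_snd).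
have Epos r : 0 < r -> E r = e r.
  by move=> r0; rewrite /E patchE mem_set//= in_itv/= r0.
have E0 r : r <= 0 -> E r = 0.
  by move=> r0; rewrite /E patchE memNset//= in_itv/= andbT; apply/negP; rewrite -leNgt.
have kpos s p r : 0 < r -> (k s p \_ pos) r = k s p r.
  by move=> r0; rewrite patchE mem_set//= in_itv/= r0.
have k0 s p r : r <= 0 -> (k s p \_ pos) r = 0.
  by move=> r0; rewrite patchE memNset//= in_itv/= andbT; apply/negP; rewrite -leNgt.
have Fs (s r : mR) : 0 < s -> F (s, r) = H s * (k s m%:R \_ pos) r.
  move=> s0; rewrite /F /=; congr (_ * _).
  have [r0|r0] := leP r 0; first by rewrite E0// k0// mul0r.
  by rewrite Epos// kpos// /e /k (gtr0_norm s0) expRD powR_mulrn ?(ltW r0)//; ring.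
have Fr (s r : mR) : 0 < r -> F (s, r) = E r * (H s * expR (- (r ^+ m * s))).
  move=> r0; rewrite /F /=.
  have [s0|s0] := leP s 0; first by rewrite Hs// !(mul0r, mulr0).
  by rewrite (gtr0_norm s0) (mulrC s); ring.
have iL l : 0 < l -> mu.-integrable setT (EFin \o (fun y => H y * expR (- (l * y)))).
  move=> l0; apply: (@integrable_dominated _ _ _ mu _ _ H) => //.
    by apply: measurable_funM => //; msr.
  move=> y _; have [y0|y0] := leP y 0; first by rewrite Hs// mul0r normr0.
  rewrite normrM !ger0_norm ?expR_ge0// ler_piMr// -expR0 ler_expR oppr_le0.
  by rewrite mulr_ge0 ?ltW.
have Ek r : 0 < r -> E r * expR (- (t * (r ^+ m) `^ theta)) = k t (theta * m%:R) r.
  move=> r0; rewrite Epos// /e /k expRD -(powR_mulrn _ (ltW r0)) -powRrM.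
  by rewrite (mulrC m%:R); ring.
have int1 (s : mR) : la.-integrable setT (EFin \o (fun r => F (s, r))).
  have [s0|s0] := leP (s : R) 0.
    rewrite (_ : (fun r => _) = fun r => 0 * H r); first exact: integrable_mull.
    by apply/funext => r; rewrite /F /= Hs// !mul0r.
  rewrite (_ : (fun r => _) = fun r => H s * (k s m%:R \_ pos) r).
    by apply: integrable_mull => //; exact: ik.
  by apply/funext => r; rewrite Fs.
have int2 (r : mR) : la.-integrable setT (EFin \o (fun s => F (s, r))).
  have [r0|r0] := leP (r : R) 0.
    rewrite (_ : (fun s => _) = fun s => 0 * H s); first exact: integrable_mull.
    by apply/funext => s; rewrite /F /= E0// !mul0r mulr0.
  rewrite (_ : (fun s => _) = fun s => E r * (H s * expR (- (r ^+ m * s)))).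
    by apply: integrable_mull => //; apply: iL; rewrite exprn_gt0.
  by apply/funext => s; rewrite Fr.
have inner (r : mR) : \int[la]_s F (s, r) = (k t (theta * m%:R) \_ pos) r.
  have [r0|r0] := leP (r : R) 0.
    rewrite k0// /Rintegral integral0_eq// => s _.
    by rewrite /F /= E0// mul0r mulr0.
  rewrite kpos//; under eq_Rintegral do rewrite Fr//.
  by rewrite RintegralZl// ?laplaceH ?Ek ?exprn_gt0//; apply: iL; rewrite exprn_gt0.
(* [H] and the exponential are nonnegative, so the sign of [F] is that of [E r] and the absolute
   value commutes with the integral in [s]. This makes the Tonelli integral computable exactly. *)
have normF (r : mR) : (\int[la]_s `|(F (s, r))%:E| =
    `|((k t (theta * m%:R) \_ pos) r)%:E|)%E.
  have [r0|r0] := leP (r : R) 0.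
    rewrite k0// abse0 integral0_eq// => s _.
    by rewrite /F /= E0// mul0r mulr0 normr0.
  rewrite kpos// -Ek//.
  transitivity (\int[la]_s (`|E r| * (H s * expR (- (r ^+ m * s))))%:E)%E.
    apply: eq_integral => s _; rewrite Fr//= normrM; congr (_ * _)%:E.
    by rewrite ger0_norm// mulr_ge0 ?expR_ge0.
  have rm0 : 0 < (r : R) ^+ m by rewrite exprn_gt0.
  have iLE := integrable_mull mu setT `|E r| _ measurableT (iL _ rm0).
  rewrite -[LHS]fineK; last exact: (integrable_fin_num measurableT iLE).
  rewrite -[fine _]/(\int[mu]_s (`|E r| * (H s * expR (- (r ^+ m * s))))).
  rewrite (RintegralZl _ measurableT (iL _ rm0)) laplaceH//= normrM.
  by rewrite (ger0_norm (expR_ge0 _)).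
have iF : (la \x la)%E.-integrable setT (EFin \o F).
  apply/(integrable21ltyP la la); first exact/measurable_EFinP.
  under eq_integral => r _ do rewrite normF.
  by have /integrableP[] := ik t _ thetam t0.
have AF : (fun s => A s * H s) = (fun s : mR => \int[la]_r F (s, r)).
  apply/funext => s; have [s0|s0] := leP s 0.
    rewrite Hs// mulr0 /Rintegral integral0_eq// => r _.
    by rewrite /F /= Hs// mul0r.
  under eq_Rintegral do rewrite Fs//.
  by rewrite RintegralZl ?(ik s m%:R)// -Rintegral_mkcond AE// mulrC.
split; first by rewrite AF; exact: (integrable_Rintegral1 la la F iF int1).
transitivity (\int[la]_s (\int[la]_r F (s, r))%:E)%E.
  by apply: eq_integral => s _; congr (_%:E); exact: (congr1 (@^~ s) AF).
rewrite (Fubini_EFin la la F iF int1 int2) Rintegral_mkcond.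
under eq_integral do rewrite inner.
rewrite fineK//.
exact: (integrable_fin_num measurableT (ik t _ thetam t0)).
Qed.

End Superposition.

(** * Trigonometric moments of the stable density *)

Section StableCharacteristicFunction.
Context {R : realType}.
Notation mu := (@lebesgue_measure R).

Lemma cexpE (a b : R) :
  cexp (complex.Complex a b) = complex.Complex (expR a * cos b) (expR a * sin b).
Proof.
rewrite /cexp /=; apply/eqP; rewrite complex.eq_complex /=.
by rewrite !mul0r subr0 addr0 !eqxx.
Qed.

(** For [g > 0] the sign in the exponent is [1]; comparing real and imaginary parts of the
    characteristic function gives the two integrals. *)
Lemma stable_char_density (theta t g : R) d (T : measurableType d)
    (P : probability T R) (S : R -> {RV P >-> R}) (f : R -> R) :
  stable_subordinator theta S -> 0 <= t -> 0 < g -> has_density_on_pos (S t) f ->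
  let H := f \_ (`]0%R, +oo[%classic : set R) in
  \int[mu]_y (cos (g * y) * H y) =
    expR (- (t * g `^ theta * cos (theta * (pi / 2)))) *
    cos (t * g `^ theta * sin (theta * (pi / 2))) /\
  \int[mu]_y (sin (g * y) * H y) =
    expR (- (t * g `^ theta * cos (theta * (pi / 2)))) *
    sin (t * g `^ theta * sin (theta * (pi / 2))).
Proof.
move=> [_ /(_ t g)] + t0 g0 df /=; move/(_ t0).
rewrite /char_fun (expectation_density _ _ df (fun y => cos (g * y))); last by msr.
rewrite (expectation_density _ _ df (fun y => sin (g * y))); last by msr.
rewrite (gtr0_norm g0) (gtr0_sg g0) mulr1.
have -> : cexp (- complex.Complex 0 (theta * pi / 2)) =
    complex.Complex (cos (theta * (pi / 2))) (- sin (theta * (pi / 2))).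
  rewrite (_ : - _ = complex.Complex 0 (- (theta * (pi / 2)))).
    by rewrite cexpE expR0 !mul1r cosN sinN.
  by apply/eqP; rewrite complex.eq_complex /= oppr0 mulrA !eqxx.
rewrite (_ : _ * complex.Complex _ _ = complex.Complex
   (- (t * g `^ theta * cos (theta * (pi / 2))))
   (t * g `^ theta * sin (theta * (pi / 2)))); last first.
  apply/eqP; rewrite complex.eq_complex /=.
  by apply/andP; split; apply/eqP; ring.
by rewrite cexpE => -[].
Qed.

End StableCharacteristicFunction.

(** * The subordinated pseudo-density as a generalized gamma expectation *)

Theorem theorem2 (R : realType) (n : nat) (theta : R)
    (d : measure_display) (Omega : measurableType d) (P : probability Omega R)
    (S : R -> {RV P >-> R}) (h : R -> R -> R) :
  (1 <= n)%N -> 0 < theta -> theta < 1 ->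
  stable_subordinator theta S ->
  (forall t : R, 0 < t -> has_density_on_pos (S t) (fun s => h s t)) ->
  1 < theta * (2 * n + 1)%:R ->
  forall t x : R, 0 < t -> x != 0 ->
  forall (d' : measure_display) (Omega' : measurableType d')
    (Q : probability Omega' R) (G : {RV Q >-> R}),
  has_density_on_pos G
    (fun y => gen_gamma_pdf (theta * (2 * n + 1)%:R) y (1 / t)) ->
  subordinated_density n h x t =
  ((1 / (pi * x))%R%:E *
   'E_Q[fun w => (expR (- coef_b n * x * G w) * sin (coef_a n * x * G w))%R])%E.
Proof.
move=> n1 th0 th1 stS dens thm t x t0 x0 d' Omega' Q G dG.
have dt := dens t t0.
pose pos := `]0%R, +oo[%classic : set R.
pose m := (2 * n + 1)%N; pose f0 : R := pi / (2 * m%:R).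
pose H := (fun s => h s t) \_ pos.
have mH : measurable_fun setT H := density_measurable _ _ dt.
have H0 : forall y, 0 <= H y := density_ge0 _ _ dt.
have iH := density_integrable _ _ dt.
have Hs y : y <= 0 -> H y = 0.
  by move=> y0; rewrite /H patchE memNset// /pos/= in_itv/= andbT; apply/negP; rewrite -leNgt.
have th01 : 0 < theta < 1 by rewrite th0.
have charH g (g0 : 0 < g) := stable_char_density _ _ g _ _ _ S _ stS (ltW t0) g0 dt.
have lapH := laplace_transform H t theta mH H0 Hs iH (ltW t0) th01
  (fun g g0 => (charH g g0).1) (fun g g0 => (charH g g0).2).
have m1 : (1 < m)%N by rewrite /m; lia.
pose A s := \int[lebesgue_measure]_(r in pos)
  (expR (- (sin f0 * x * r) - s * r `^ m%:R) * cos (f0 + cos f0 * x * r)).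
have [iA EA] := laplace_superposition H m f0 x t theta mH H0 Hs iH t0 m1 thm lapH A
  (fun s _ => erefl).
have mpos := @measurable_pos R.
(* The rotated integral is moved to the open half-line, and its natural power is read as a real
   power to match [A]. *)
have AE s : 0 < s -> pseudo_density n x s = pi^-1 * A s.
  move=> s0; rewrite pseudo_densityE//; congr (_ * _).
  rewrite -Rintegral_itv_obnd_cbnd.
    apply: eq_Rintegral => r; rewrite inE /pos/= in_itv/= andbT => r0.
    by rewrite powR_mulrn// ltW.
  have := @integrable_damped_cos R m%:R s x f0 _ s0; rewrite ltr1n => /(_ m1).
  apply: eq_integrable => // r; rewrite inE /pos/= in_itv/= andbT => r0.
  by rewrite powR_mulrn// ltW.
rewrite /subordinated_density integral_mkcond.
transitivity (\int[lebesgue_measure]_s (pi^-1 * (A s * H s))%:E)%E.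
  apply: eq_integral => s _; rewrite /H !patchE; case: ifPn => spos; last by rewrite !mulr0.
  rewrite AE ?mulrA//.
  by move: spos; rewrite inE /pos/= in_itv/= andbT.
under eq_integral do rewrite EFinM.
rewrite integralZl// EA.
pose g y := expR (- coef_b n * x * y) * sin (coef_a n * x * y).
rewrite (expectation_density _ _ dG g); last by rewrite /g; msr.
set gam := theta * (2 * n + 1)%:R.
(* At [tau = 1 / t] the gamma density is [gam t y ^ (gam - 1) exp (- t y ^ gam)], which makes the
   expectation the damped sine integral. *)
have -> : (\int[lebesgue_measure]_y
    (g y * ((fun y => gen_gamma_pdf gam y (1 / t)) \_ pos) y)%:E =
    (\int[lebesgue_measure]_(y in pos) (expR (- (sin f0 * x * y) - t * y `^ gam) *
       sin (cos f0 * x * y) * (gam * t * y `^ (gam - 1))))%:E)%E.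
  have iS := @integrable_damped_sin R gam t x f0 thm t0.
  rewrite /Rintegral fineK; last exact: (integrable_fin_num mpos iS).
  rewrite [RHS]integral_mkcond; apply: eq_integral => y _; rewrite !patchE.
  case: ifP => _; last by rewrite mulr0.
  rewrite /g /gen_gamma_pdf div1r invrK expRD; congr (_%:E).
  rewrite (_ : coef_b n = sin f0)// (_ : coef_a n = cos f0)// !mulNr.
  rewrite [y `^ gam * t]mulrC.
  by ring.
(* Integration by parts produces a factor [x], cancelled against [1 / (pi x)] since [x] is
   nonzero. *)
rewrite damped_by_parts// -!EFinM; congr (_%:E).
by rewrite div1r invfM -mulrA mulKf.
Qed.
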